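(* Let $\mathbb{K}$ be a field. The graded vector subspace of $\mathrm{ParQSym}$ spanned by the $M_\pi$ with $\pi$ a partition diagram all of whose upper nodes are isolated (including $\pi=\emptyset$) is a Hopf subalgebra of $\mathrm{ParQSym}$.
   Context: **Partition diagrams.** A partition diagram of order $k\ge 0$ is a set partition of $\{1,\dots,k,1',\dots,k'\}$ ($1,\dots,k$ are the upper nodes, $1',\dots,k'$ the lower nodes); for $k=0$ the only one is the empty diagram $\emptyset$. A node is isolated if it forms a block of size one. For $\pi$ of order $k$ and $\rho$ of order $m$, $\pi\otimes\rho$ is the diagram of order $k+m$ whose blocks are the blocks of $\pi$ and the blocks of $\rho$ with labels shifted by $k$ ($i\mapsto i+k$, $i'\mapsto (i+k)'$). If $k,m\ge1$, $\pi\bullet\rho$ is obtained from $\pi\otimes\rho$ by merging the block containing $k'$ with the block containing $(k+1)'$. The empty diagram is the unit for both operations. A diagram is $\otimes$-irreducible if it is not of the form $\rho\otimes\sigma$ with $\rho,\sigma$ both non-empty (so $\emptyset$ is $\otimes$-irreducible). Every non-empty $\pi$ is uniquely $\pi_1\otimes\cdots\otimes\pi_l$ with all $\pi_i$ non-empty and $\otimes$-irreducible. **ParQSym.** $\mathrm{ParQSym}=\bigoplus_{i\ge0}\mathrm{ParQSym}_i$, where $\mathrm{ParQSym}_i$ is the $\mathbb{K}$-vector space with basis $\{M_\pi:\pi\text{ of order }i\}$. Coproduct: $\Delta M_\sigma=\sum_{\pi\otimes\rho=\sigma}M_\pi\otimes M_\rho$, over all ordered pairs of (possibly empty) diagrams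 with $\pi\otimes\rho=\sigma$. Counit: $\varepsilon(M_\pi)=\delta_{\pi,\emptyset}$. Product: $M_\emptyset$ is the unit; for non-empty $\rho=\rho_1\otimes\cdots\otimes\rho_n$, $\sigma=\sigma_1\otimes\cdots\otimes\sigma_m$ with all $\rho_i,\sigma_j$ non-empty $\otimes$-irreducible, $$M_\rho\star M_\sigma=\sum M_{(\rho'_1\bullet\sigma'_1)\otimes\cdots\otimes(\rho'_k\bullet\sigma'_k)},$$ over all $k\in\mathbb{N}$ and all pairs of sequences of diagrams $(\rho'_1,\dots,\rho'_k)$, $(\sigma'_1,\dots,\sigma'_k)$ that become $(\rho_1,\dots,\rho_n)$, respectively $(\sigma_1,\dots,\sigma_m)$, after deleting all empty diagrams, and such that $\rho'_s\bullet\sigma'_s\ne\emptyset$ for all $1\le s\le k$. With these operations $\mathrm{ParQSym}$ is a connected graded bialgebra, hence a Hopf algebra. *)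

(* Defs.v *)
From HB Require Import structures.
From mathcomp Require Import all_boot all_order all_algebra.

Set Implicit Arguments.
Unset Strict Implicit.
Unset Printing Implicit Defensive.

Import GRing.Theory.

Local Open Scope ring_scope.

(* [inl i] is the upper node i + 1 and [inr i] the lower node (i + 1)'. *)
Definition node (k : nat) : Type := ('I_k + 'I_k)%type.
HB.instance Definition _ (k : nat) := Finite.on (node k).

Definition diagram (k : nat) : Type :=
  {P : {set {set node k}} | partition P [set: node k]}.
HB.instance Definition _ (k : nat) := SubType.on (diagram k).
HB.instance Definition _ (k : nat) := Finite.on (diagram k).

Definition Diagram (k : nat) (P : {set {set node k}})
    (partP : partition P [set: node k]) : diagram k :=
  exist (fun B : {set {set node k}} => partition B [set: node k]) P partP.

(* Partition diagrams of arbitrary order; the order is the tag. *)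
Definition pdiagram : Type := {k : nat & diagram k}.
HB.instance Definition _ := Choice.on pdiagram.

Definition pd_order (p : pdiagram) : nat := tag p.

Definition shl (k m : nat) (x : node k) : node (k + m) :=
  match x with inl i => inl (lshift m i) | inr i => inr (lshift m i) end.

Definition shr (k m : nat) (x : node m) : node (k + m) :=
  match x with inl i => inl (rshift k i) | inr i => inr (rshift k i) end.

Arguments shl {k} m x.
Arguments shr k {m} x.

Lemma shl_inj k m : injective (@shl k m).
Proof. by move=> [i|i] [j|j] //= [] /eqP h; congr (_ _); apply/val_inj/eqP. Qed.

Lemma shr_inj k m : injective (@shr k m).
Proof.
by move=> [i|i] [j|j] //= [] /eqP; rewrite eqn_add2l => h;
   congr (_ _); apply/val_inj/eqP.
Qed.

Lemma shlr_neq k m (x : node k) (y : node m) : shl m x <> shr k y.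
Proof.
by case: x y => [i|i] [j|j] //= [] /eqP h; have := ltn_ord i;
   rewrite (eqP h) ltnNge leq_addr.
Qed.

Variant shlr_spec k m : node (k + m) -> Type :=
  | ShlSpec x : shlr_spec (shl m x)
  | ShrSpec y : shlr_spec (shr k y).

Lemma shlrP k m (z : node (k + m)) : shlr_spec z.
Proof.
case: z => i; case: (split_ordP i) => j ->.
- exact: (ShlSpec _ (inl j)).
- exact: (ShrSpec _ (inl j)).
- exact: (ShlSpec _ (inr j)).
- exact: (ShrSpec _ (inr j)).
Qed.

Lemma partitionI (T : finType) (P : {set {set T}}) :
  (forall x, exists2 B, B \in P & x \in B) ->
  (forall A B x, A \in P -> B \in P -> x \in A -> x \in B -> A = B) ->
  set0 \notin P -> partition P [set: T].
Proof.
move=> cov triv P0; apply/and3P; split=> //.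
- apply/eqP/setP=> x; rewrite inE; have [B PB xB] := cov x.
  by apply/bigcupP; exists B.
- apply/trivIsetP=> A B PA PB; apply: contraR => /pred0Pn[x /andP[/= xA xB]].
  by apply/eqP/(triv A B x).
Qed.

Lemma partitionE (T : finType) (P : {set {set T}}) :
  partition P [set: T] ->
  [/\ forall x, exists2 B, B \in P & x \in B,
      forall A B x, A \in P -> B \in P -> x \in A -> x \in B -> A = B
    & set0 \notin P].
Proof.
case/and3P=> /eqP cov triv P0; split=> // [x|A B x PA PB xA xB].
  have: x \in cover P by rewrite cov inE.
  by case/bigcupP=> B; exists B.
by rewrite -(def_pblock triv PA xA) (def_pblock triv PB xB).
Qed.

Definition tensor_blocks (k m : nat)
    (P : {set {set node k}}) (Q : {set {set node m}}) : {set {set node (k + m)}} :=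
  [set shl m @: B | B : {set node k} in P]
    :|: [set shr k @: B | B : {set node m} in Q].

Lemma tensor_blocksP (k m : nat) (P : diagram k) (Q : diagram m) :
  partition (tensor_blocks (val P) (val Q)) [set: node (k + m)].
Proof.
have [covP trivP P0] := partitionE (valP P).
have [covQ trivQ Q0] := partitionE (valP Q).
apply: partitionI => [z|A B z|].
- case: (shlrP z) => x.
  + have [B PB xB] := covP x; exists (shl m @: B); last exact: imset_f.
    by apply/setUP; left; apply: imset_f.
  + have [B PB xB] := covQ x; exists (shr k @: B); last exact: imset_f.
    by apply/setUP; right; apply: imset_f.
- case/setUP=> /imsetP[A' PA ->]; case/setUP=> /imsetP[B' PB ->].
  + case/imsetP=> x xA -> /imsetP[y yB /shl_inj xy].
    by rewrite (trivP A' B' x) // xy.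
  + by case/imsetP=> x _ -> /imsetP[y _ /shlr_neq].
  + by case/imsetP=> x _ -> /imsetP[y _ /esym/shlr_neq].
  + case/imsetP=> x xA -> /imsetP[y yB /shr_inj xy].
    by rewrite (trivQ A' B' x) // xy.
- apply/setUP=> -[] /imsetP[B BP /esym/eqP]; rewrite imset_eq0 => /eqP B0.
  + by rewrite -B0 BP in P0.
  + by rewrite -B0 BP in Q0.
Qed.

(* The partition P with the blocks of x and of y merged. *)
Definition merge_blocks (T : finType) (x y : T) (P : {set {set T}}) : {set {set T}} :=
  (pblock P x :|: pblock P y) |: (P :\ pblock P x :\ pblock P y).

Lemma merge_blocksP (T : finType) (x y : T) (P : {set {set T}}) :
  partition P [set: T] -> partition (merge_blocks x y P) [set: T].
Proof.
move=> partP; have [cov triv P0] := partitionE partP.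
have [/eqP covE tI _] := and3P partP.
have inP z : pblock P z \in P by rewrite pblock_mem // covE inE.
have inb z : z \in pblock P z by rewrite mem_pblock covE inE.
apply: partitionI => [z|A B z|].
- have [zx|nzx] := boolP (z \in pblock P x :|: pblock P y).
    by exists (pblock P x :|: pblock P y) => //; rewrite setU11.
  exists (pblock P z) => //.
  rewrite !inE inP andbT; apply/orP; right; rewrite inE negb_or in nzx.
  by case/andP: nzx => nx ny; apply/andP; split;
     [apply: contraNneq ny|apply: contraNneq nx] => <-.
- rewrite !inE => /predU1P[->|/and3P[Ay Ax PA]] /predU1P[->|/and3P[By Bx PB]] //.
  + rewrite inE => /orP[zx|zy] zB.
      by rewrite (triv _ _ z PB (inP x) zB zx) eqxx in Bx.
    by rewrite (triv _ _ z PB (inP y) zB zy) eqxx in By.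
  + rewrite inE => zA /orP[zx|zy].
      by rewrite (triv _ _ z PA (inP x) zA zx) eqxx in Ax.
    by rewrite (triv _ _ z PA (inP y) zA zy) eqxx in Ay.
  + exact: triv.
- rewrite !inE (negPf P0) !andbF orbF; apply/eqP=> /setP/(_ x).
  by rewrite !inE inb.
Qed.

Lemma empty_blocksP : partition (set0 : {set {set node 0}}) [set: node 0].
Proof. by apply: partitionI => [[[]|[]]|A B x|] //; rewrite inE. Qed.

Definition empty_diagram : diagram 0 := Diagram empty_blocksP.

Definition pd_empty : pdiagram := Tagged diagram empty_diagram.

Definition tensor_diagram (k m : nat) (P : diagram k) (Q : diagram m) :
  diagram (k + m) := Diagram (tensor_blocksP P Q).

Definition tensor (p q : pdiagram) : pdiagram :=
  Tagged diagram (tensor_diagram (tagged p) (tagged q)).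

Definition bullet_diagram (k m : nat) (P : diagram k.+1) (Q : diagram m.+1) :
  diagram (k.+1 + m.+1) :=
  Diagram (merge_blocksP (shl m.+1 (inr ord_max)) (shr k.+1 (inr ord0))
               (tensor_blocksP P Q)).

Definition bullet (p q : pdiagram) : pdiagram :=
  match p, q with
  | existT 0 _, _ => q
  | _, existT 0 _ => p
  | existT k.+1 P, existT m.+1 Q => Tagged diagram (bullet_diagram P Q)
  end.

Definition irreducible (p : pdiagram) : Prop :=
  forall q r : pdiagram, p = tensor q r -> q = pd_empty \/ r = pd_empty.

(* p = p_1 (x) ... (x) p_n with all p_i non-empty and irreducible;
   the empty sequence is the factorization of the empty diagram. *)
Definition factorization (p : pdiagram) (s : seq pdiagram) : Prop :=
  (forall q, q \in s -> q != pd_empty /\ irreducible q) /\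
  p = foldr tensor pd_empty s.

Definition nonempty_entries (s : seq pdiagram) : seq pdiagram :=
  [seq q <- s | q != pd_empty].

Definition upper_isolated (p : pdiagram) : Prop :=
  forall i : 'I_(pd_order p), [set inl i] \in val (tagged p).

(* Imported only here: classical_sets redefines partition, pblock and other
   names of finset that are used above. *)
From mathcomp Require Import finmap.
From mathcomp Require Import boolp classical_sets cardinality fsbigop.
From mathcomp Require Import monalg.

Local Open Scope classical_set_scope.
Local Open Scope ring_scope.

(* A pair of sequences of the same length is encoded as a sequence of pairs. *)
Definition paddings (p q : pdiagram) : set (seq (pdiagram * pdiagram)) :=
  [set s | [/\ factorization p (nonempty_entries (unzip1 s)),
               factorization q (nonempty_entries (unzip2 s))
             & forall t, t \in s -> bullet t.1 t.2 != pd_empty]].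

Definition deconcatenations (p : pdiagram) : set (pdiagram * pdiagram) :=
  [set t | tensor t.1 t.2 = p].

(* The index sets of the product and of the coproduct are finite, so that the
   sums over them below, which are 0 by convention on an infinite support, are
   the intended ones. *)
Lemma order_eq0 p : (pd_order p == 0%N) = (p == pd_empty).
Proof.
apply/eqP/eqP=> [|->] //; case: p => k P /= ek; rewrite /pd_order /= in ek.
subst k; congr existT; apply/val_inj/finset.setP=> B /=; rewrite finset.in_set0.
have [_ _ P0] := partitionE (valP P); apply: contraNF P0 => PB.
suff <- : B = finset.set0 by [].
by apply/finset.setP=> -[[]|[]].
Qed.

Lemma order_tensor p q : pd_order (tensor p q) = (pd_order p + pd_order q)%N.
Proof. by []. Qed.

Lemma order_bullet p q : pd_order (bullet p q) = (pd_order p + pd_order q)%N.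
Proof. by case: p q => [[|k] P] [[|m] Q] //; rewrite /pd_order /= addn0. Qed.

Lemma finite_order_le (n : nat) : finite_set [set p : pdiagram | (pd_order p <= n)%N].
Proof.
pose f (t : {k : 'I_n.+1 & diagram k}) : pdiagram :=
  Tagged diagram (tagged t).
apply: (@sub_finite_set _ _ (f @` setT)); last first.
  by apply: finite_image; apply: finite_finset.
move=> [k P] /= kn.
by exists (Tagged (fun k : 'I_n.+1 => diagram k) (P : diagram (Ordinal (kn : (k < n.+1)%N)))).
Qed.

Lemma finite_deconcatenations p : finite_set (deconcatenations p).
Proof.
apply: (@sub_finite_set _ _ ([set q | (pd_order q <= pd_order p)%N] `*`
                              [set q | (pd_order q <= pd_order p)%N])).
  move=> [q r] /= <-; rewrite order_tensor; split=> /=.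
    exact: leq_addr.
  exact: leq_addl.
by apply: finite_setX; apply: finite_order_le.
Qed.

Lemma order_factorization p (s : seq pdiagram) :
  factorization p (nonempty_entries s) -> pd_order p = sumn (map pd_order s).
Proof.
case=> _ ->; elim: s => //= q s IH.
case: ifPn => [_|/negPn/eqP ->]; first exact: (congr1 (addn (pd_order q)) IH).
by rewrite IH.
Qed.

Lemma finite_seq_bounded (T : choiceType) (A : set T) (n : nat) :
  finite_set A ->
  finite_set [set s : seq T | (size s <= n)%N /\ forall t, t \in s -> A t].
Proof.
move=> finA; elim: n => [|n IH].
  apply: (@sub_finite_set _ _ [set [::]]); last exact: finite_set1.
  by move=> s /= []; rewrite leqn0 size_eq0 => /eqP.
apply: (@sub_finite_set _ _ ([set [::]] `|` (fun t => t.1 :: t.2) @` (A `*`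
   [set s : seq T | (size s <= n)%N /\ forall t, t \in s -> A t]))).
  case=> [|a s] /= [ss sA]; [by left|right].
  exists (a, s) => //=; split=> /=; first by apply: sA; rewrite inE eqxx.
  by split=> // t ts; apply: sA; rewrite inE ts orbT.
rewrite finite_setU; split; first exact: finite_set1.
by apply: finite_image; apply: finite_setX.
Qed.

Lemma finite_paddings p q : finite_set (paddings p q).
Proof.
pose n := (pd_order p + pd_order q)%N.
pose D := [set r : pdiagram | (pd_order r <= n)%N].
apply: (@sub_finite_set _ _ [set s : seq (pdiagram * pdiagram) |
    (size s <= n)%N /\ forall t, t \in s -> (D `*` D) t]); last first.
  by apply: finite_seq_bounded; apply: finite_setX; apply: finite_order_le.
move=> s [/order_factorization ep /order_factorization eq0 ne] /=.
have en : n = sumn [seq (pd_order t.1 + pd_order t.2)%N | t <- s].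
  rewrite /n ep eq0; elim: (s) => //= t s' IH.
  by rewrite -IH addnACA.
rewrite en; split.
  elim: s ne {ep eq0 en} => //= t s IH ne; rewrite -add1n leq_add //.
    by have := ne t; rewrite inE eqxx -order_eq0 order_bullet -lt0n; apply.
  by apply: IH => u us; apply: ne; rewrite inE us orbT.
have {ne ep eq0} le t : t \in s -> (pd_order t.1 + pd_order t.2 <= n)%N.
  rewrite en; elim: (s) => //= u s' IH; rewrite inE => /predU1P[->|/IH h].
    exact: leq_addr.
  exact: leq_trans h (leq_addl _ _).
move=> t /le h; split; rewrite /D /=; apply: leq_trans h.
  exact: leq_addr.
exact: leq_addl.
Qed.

Notation ParQSym K := {malg K[pdiagram]}.

(* ParQSym (x) ParQSym, as the space with basis the pairs of diagrams. *)
Notation ParQSym2 K := {malg K[(pdiagram * pdiagram)%type]}.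

Section Linear.
Variables (K : fieldType) (B : choiceType) (V : lmodType K).

Definition lin_ext (f : B -> V) (x : {malg K[B]}) : V :=
  \sum_(b <- msupp x) x@_b *: f b.

Definition lin_span (G : set V) : set V :=
  [set v | exists (n : nat) (a : 'I_n -> K) (g : 'I_n -> V),
     (forall i, G (g i)) /\ v = \sum_i a i *: g i].

Definition subspace (W : set V) : Prop :=
  [/\ W 0, forall x y, W x -> W y -> W (x + y) & forall a x, W x -> W (a *: x)].

End Linear.

Section ParQSym.
Variable K : fieldType.
Implicit Types (x y : ParQSym K) (W : set (ParQSym K)).

Definition M (p : pdiagram) : ParQSym K := << p >>.

Definition tens x y : ParQSym2 K :=
  lin_ext (fun p => lin_ext (fun q => << (p, q) >>) y) x.

(* If p or q is empty, this sum is the single term M q, respectively M p. *)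
Definition pqs_mulM (p q : pdiagram) : ParQSym K :=
  \sum_(s \in paddings p q) M (foldr tensor pd_empty [seq bullet t.1 t.2 | t <- s]).

Definition pqs_mul x y : ParQSym K :=
  lin_ext (fun p => lin_ext (fun q => pqs_mulM p q) y) x.

Definition pqs_comulM (p : pdiagram) : ParQSym2 K :=
  \sum_(t \in deconcatenations p) tens (M t.1) (M t.2).

Definition pqs_comul x : ParQSym2 K := lin_ext pqs_comulM x.

Definition pqs_one : ParQSym K := M pd_empty.

Definition pqs_counit x : K := x@_pd_empty.

Definition convolution (f g : ParQSym K -> ParQSym K) x : ParQSym K :=
  lin_ext (fun t => pqs_mul (f (M t.1)) (g (M t.2))) (pqs_comul x).

Definition is_antipode (S : {linear ParQSym K -> ParQSym K}) : Prop :=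
  forall x, convolution S id x = pqs_counit x *: pqs_one /\
            convolution id S x = pqs_counit x *: pqs_one.

Definition homogeneous_component (n : nat) x : ParQSym K :=
  \sum_(p <- msupp x | pd_order p == n) x@_p *: M p.

Definition graded_subspace W : Prop :=
  subspace W /\ forall n x, W x -> W (homogeneous_component n x).

Definition subalgebra W : Prop :=
  W pqs_one /\ forall x y, W x -> W y -> W (pqs_mul x y).

(* The image of W (x) W in ParQSym (x) ParQSym. *)
Definition tensor_square W : set (ParQSym2 K) :=
  lin_span [set z | exists x y, [/\ W x, W y & z = tens x y]].

Definition subcoalgebra W : Prop :=
  forall x, W x -> tensor_square W (pqs_comul x).

(* The antipode is the two-sided convolution inverse of the identity.  Its
   existence is part of the statement, so that stability is not vacuous. *)
Definition antipode_stable W : Prop :=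
  exists2 S : {linear ParQSym K -> ParQSym K},
    is_antipode S & forall x, W x -> W (S x).

Definition hopf_subalgebra W : Prop :=
  [/\ subspace W, subalgebra W, subcoalgebra W & antipode_stable W].

Definition upper_isolated_span : set (ParQSym K) :=
  lin_span [set x | exists2 p, upper_isolated p & x = M p].

End ParQSym.

Arguments upper_isolated_span : clear implicits.

(* Main.v *)
(** Non-empty irreducible diagrams freely generate the monoid of diagrams under
    [tensor] and are closed under the associative operation [bullet].  Hence
    ParQSym is a quasi-shuffle algebra with deconcatenation coproduct: if [L_a] is
    the operator [M p |-> M (tensor a p)], then
      [L_a x * L_b y = L_a (x * L_b y) + L_b (L_a x * y) + L_(bullet a b) (x * y)].
    The antipode reverses a word, fuses blocks of consecutive letters (keeping the
    order inside a block) and carries the sign (-1)^length; both of its convolution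
    identities follow from the displayed recursion by telescoping.  All these
    operations preserve isolation of the upper nodes, because [bullet] only merges
    blocks of lower nodes. *)

From HB Require Import structures.
Require Import Defs.
From mathcomp Require Import all_boot all_algebra zify.
From mathcomp Require boolp.

Set Implicit Arguments.
Unset Strict Implicit.
Unset Printing Implicit Defensive.

(** * Diagrams as relations *)

(* Encoding nodes in [bool * nat] makes diagrams of different orders comparable
   without casts: a diagram is determined by its order and by [linked]. *)
Definition pos (k : nat) (z : node k) : bool * nat :=
  match z with inl i => (true, nat_of_ord i) | inr i => (false, nat_of_ord i) end.

Lemma pos_inj k : injective (@pos k).
Proof. by move=> [i|i] [j|j] //= [] /val_inj ->. Qed.

Lemma pos_lt k (z : node k) : (pos z).2 < k.
Proof. by case: z => i /=. Qed.

Lemma pos_onto k (x : bool * nat) : x.2 < k -> exists z : node k, pos z = x.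
Proof.
by case: x => [[] i] /= ik; [exists (inl (Ordinal ik))|exists (inr (Ordinal ik))].
Qed.

Definition shift (k : nat) (x : bool * nat) : bool * nat := (x.1, k + x.2).

Lemma pos_shl k m (z : node k) : pos (shl m z) = pos z.
Proof. by case: z. Qed.

Lemma pos_shr k m (z : node m) : pos (shr k z) = shift k (pos z).
Proof. by case: z. Qed.

(** False when an index reaches the order, so reflexivity holds only below the order, while symmetry
    and transitivity hold everywhere. *)
Definition linked (p : pdiagram) (x y : bool * nat) : bool :=
  [exists z : node (pd_order p), exists t : node (pd_order p),
     [&& pos z == x, pos t == y & t \in pblock (val (tagged p)) z]].

Lemma linked_pos p (z t : node (pd_order p)) :
  linked p (pos z) (pos t) = (t \in pblock (val (tagged p)) z).
Proof.
apply/existsP/idP => [[z' /existsP[t' /and3P[/eqP/pos_inj-> /eqP/pos_inj->]]]|h] //.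
by exists z; apply/existsP; exists t; rewrite !eqxx.
Qed.

Lemma linked_lt p x y : linked p x y -> (x.2 < pd_order p) && (y.2 < pd_order p).
Proof.
by case/existsP=> z /existsP[t /and3P[/eqP<- /eqP<- _]]; rewrite !pos_lt.
Qed.

Lemma mem_pblockE (T : finType) (P : {set {set T}}) (B : {set T}) z t :
  partition P [set: T] -> B \in P -> z \in B -> (t \in pblock P z) = (t \in B).
Proof. by case/and3P=> _ trivP _ BP zB; rewrite (def_pblock trivP BP zB). Qed.

Lemma pblock_block (T : finType) (P : {set {set T}}) z :
  partition P [set: T] -> pblock P z \in P /\ z \in pblock P z.
Proof.
by case/and3P=> /eqP cov _ _; rewrite mem_pblock pblock_mem cov inE.
Qed.

Lemma linked_refl p x : x.2 < pd_order p -> linked p x x.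
Proof.
by case/pos_onto=> z <-; rewrite linked_pos; case: (pblock_block z (valP (tagged p))).
Qed.

Lemma linked_sym p x y : linked p x y = linked p y x.
Proof.
wlog suff: x y / linked p x y -> linked p y x by move=> h; apply/idP/idP; apply: h.
move=> xy; have /andP[/pos_onto[z ez] /pos_onto[t et]] := linked_lt xy; subst.
move: xy; rewrite !linked_pos.
have [BP zB] := pblock_block z (valP (tagged p)).
by move=> tB; rewrite (mem_pblockE _ (valP (tagged p)) BP tB).
Qed.

Lemma linked_trans p : transitive (linked p).
Proof.
move=> y x w xy yw; have /andP[/pos_onto[z ez] /pos_onto[t et]] := linked_lt xy.
have /andP[_ /pos_onto[u eu]] := linked_lt yw; subst.
move: xy yw; rewrite !linked_pos.
have [BP zB] := pblock_block z (valP (tagged p)).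
by move=> tB; rewrite (mem_pblockE _ (valP (tagged p)) BP tB).
Qed.

(** Every block is non-empty, hence is the [pblock] of one of its elements, and [linked] determines
    each [pblock]. *)
Lemma pdiagramP (p q : pdiagram) :
  pd_order p = pd_order q -> linked p =2 linked q -> p = q.
Proof.
case: p q => [k P] [l Q] /= kl; rewrite /pd_order /= in kl; subst l => PQ.
congr existT; apply/val_inj.
have eb z : pblock (val P) z = pblock (val Q) z.
  by apply/setP=> t; have := PQ (pos z) (pos t); rewrite !linked_pos.
wlog suff: P Q PQ eb / val P \subset val Q.
  by move=> h; apply/eqP; rewrite eqEsubset !h // => x y; rewrite PQ.
apply/subsetP=> B BP; have [_ _ P0] := and3P (valP P).
have /set0Pn[z zB] : B != set0 by apply: contraNneq P0 => <-.
have [_ trivP _] := and3P (valP P).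
rewrite -(def_pblock trivP BP zB) eb.
by case: (pblock_block z (valP Q)).
Qed.

(** Restricts a diagram to part of its columns when [f] is [shl] or [shr]; this supplies the two
    factors at a cut. *)
Definition pull (k m : nat) (f : node m -> node k) (P : diagram k) : diagram m :=
  Diagram (preim_partitionP (fun z => pblock (val P) (f z)) [set: node m]).

Lemma linked_pull k m (f : node m -> node k) (P : diagram k) z t :
  linked (Tagged diagram (pull f P)) (pos z) (pos t) =
  linked (Tagged diagram P) (pos (f z)) (pos (f t)).
Proof.
rewrite (@linked_pos (Tagged diagram (pull f P))) (@linked_pos (Tagged diagram P)) /=.
rewrite pblock_equivalence_partition ?inE //; last by split=> // /eqP->.
have [_ trivP _] := and3P (valP P).
have [BP zB] := pblock_block (f z) (valP P).
by rewrite eq_pblock //; case/and3P: (valP P) => /eqP -> _ _; rewrite inE.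
Qed.

Lemma linked_tensorl p q x y : x.2 < pd_order p -> y.2 < pd_order p ->
  linked (tensor p q) x y = linked p x y.
Proof.
case/pos_onto=> z <- /pos_onto[t <-].
rewrite -(pos_shl (pd_order q) z) -(pos_shl (pd_order q) t).
rewrite (@linked_pos (tensor p q)) !pos_shl linked_pos.
have [BP zB] := pblock_block z (valP (tagged p)).
rewrite (@mem_pblockE _ _ (shl _ @: pblock (val (tagged p)) z) _ _
  (tensor_blocksP _ _)).
- by rewrite mem_imset //; apply: shl_inj.
- by apply/setUP; left; apply: imset_f.
- exact: imset_f.
Qed.

Lemma linked_tensorr p q x y :
  linked (tensor p q) (shift (pd_order p) x) (shift (pd_order p) y) = linked q x y.
Proof.
have [|nlt] := boolP ((x.2 < pd_order q) && (y.2 < pd_order q)); last first.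
  apply/idP/idP => /linked_lt; last by rewrite (negPf nlt).
  by rewrite /= !ltn_add2l (negPf nlt).
case/andP=> /pos_onto[z <-] /pos_onto[t <-].
rewrite -(pos_shr (pd_order p) z) -(pos_shr (pd_order p) t).
rewrite (@linked_pos (tensor p q)) linked_pos.
have [BP zB] := pblock_block z (valP (tagged q)).
rewrite (@mem_pblockE _ _ (shr _ @: pblock (val (tagged q)) z) _ _
  (tensor_blocksP _ _)).
- by rewrite mem_imset //; apply: shr_inj.
- by apply/setUP; right; apply: imset_f.
- exact: imset_f.
Qed.

Lemma linked_tensorlr p q x y :
  linked (tensor p q) x y -> (x.2 < pd_order p) = (y.2 < pd_order p).
Proof.
move=> xy; have /andP[/pos_onto[z ez] /pos_onto[t et]] := linked_lt xy; subst.
move: xy; rewrite linked_pos.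
have [BP zB] := pblock_block z (valP (tagged (tensor p q))).
move: BP zB; set B := pblock _ _; case/setUP => /imsetP[C _ ->];
  move=> /imsetP[z' _ ->] /imsetP[t' _ ->].
  by rewrite !pos_shl !pos_lt.
by rewrite !pos_shr /= !ltnNge !leq_addr.
Qed.

(** * Links in a [bullet] *)

Lemma linked_merge (T : finType) (P : {set {set T}}) x y z t :
  partition P [set: T] ->
  (t \in pblock (merge_blocks x y P) z) =
  (t \in pblock P z) ||
  ((z \in pblock P x :|: pblock P y) && (t \in pblock P x :|: pblock P y)).
Proof.
move=> partP; have partM := merge_blocksP x y partP.
have [zU|zU] /= := boolP (z \in pblock P x :|: pblock P y).
  rewrite (@mem_pblockE _ _ (pblock P x :|: pblock P y) _ _ partM) ?setU11 //.
  apply/idP/idP => [->|/orP[]//]; first by rewrite orbT.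
  have [xP xx] := pblock_block x partP; have [yP yy] := pblock_block y partP.
  by case/setUP: zU => zU; rewrite (mem_pblockE _ partP _ zU) // => tU;
     rewrite inE tU ?orbT.
have [zP zz] := pblock_block z partP.
rewrite orbF (@mem_pblockE _ _ (pblock P z) _ _ partM) //.
rewrite !inE zP andbT; apply/orP; right; apply/andP.
rewrite inE negb_or in zU; case/andP: zU => zx zy.
by split; [apply: contraNneq zy|apply: contraNneq zx] => <-.
Qed.

(** The gluing points of [bullet]: $k'$ in the left factor and, as [leftmost], $1'$ in the right
    one. For order 0 the predecessor gives the index 0, which is no node. *)
Definition rightmost (p : pdiagram) : bool * nat := (false, (pd_order p).-1).
Definition leftmost : bool * nat := (false, 0).

Section Bullet.
Variables p q : pdiagram.
Hypotheses (p0 : 0 < pd_order p) (q0 : 0 < pd_order q).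

Lemma linked_bullet x y :
  linked (bullet p q) x y =
  linked (tensor p q) x y ||
  ((linked (tensor p q) (rightmost p) x ||
    linked (tensor p q) (shift (pd_order p) leftmost) x) &&
   (linked (tensor p q) (rightmost p) y ||
    linked (tensor p q) (shift (pd_order p) leftmost) y)).
Proof.
case: p q p0 q0 => [[//|k] P] [[//|m] Q] _ _.
set b := bullet _ _; set s := tensor _ _.
have [xy|nlt] := boolP ((x.2 < pd_order s) && (y.2 < pd_order s)); last first.
  transitivity false.
    by apply/negbTE; apply: contraNN nlt => /linked_lt.
  apply/esym/negbTE; apply: contraNN nlt => /orP[/linked_lt //|/andP[]].
  by case/orP=> /linked_lt /andP[_ ->]; case/orP=> /linked_lt /andP[_ ->].
case/andP: xy => /pos_onto[z <-] /pos_onto[t <-].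
pose xr : node (k.+1 + m.+1) := shl m.+1 (inr ord_max).
pose yl : node (k.+1 + m.+1) := shr k.+1 (inr ord0).
have -> : rightmost (existT _ k.+1 P) = pos xr by [].
have -> : shift (pd_order (existT (fun k => diagram k) k.+1 P)) leftmost = pos yl.
  by rewrite /yl pos_shr.
rewrite !(@linked_pos s) (@linked_pos b) /=.
by rewrite linked_merge ?inE //; apply: tensor_blocksP.
Qed.

Lemma rightmost_lt : (rightmost p).2 < pd_order p. Proof. by rewrite /= prednK. Qed.

(** The merged block meets the columns of [p] exactly in the block of [rightmost p], so merging
    creates no new link there. *)
Lemma linked_bulletl x y : x.2 < pd_order p -> y.2 < pd_order p ->
  linked (bullet p q) x y = linked p x y.
Proof.
move=> xp yp; rewrite linked_bullet.
have F z : z.2 < pd_order p ->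
   linked (tensor p q) (shift (pd_order p) leftmost) z = false.
  by move=> zp; apply/negbTE/negP => /linked_tensorlr; rewrite zp /= addn0 ltnn.
rewrite !F // !orbF !linked_tensorl ?rightmost_lt //.
apply/orP/idP; last by left.
by case=> // /andP[]; rewrite linked_sym; apply: linked_trans.
Qed.

Lemma linked_bulletr x y :
  linked (bullet p q) (shift (pd_order p) x) (shift (pd_order p) y) = linked q x y.
Proof.
rewrite linked_bullet.
have F z : linked (tensor p q) (rightmost p) (shift (pd_order p) z) = false.
  by apply/negbTE/negP => /linked_tensorlr; rewrite rightmost_lt /= ltnNge leq_addr.
rewrite !F // !linked_tensorr /=.
apply/orP/idP; last by left.
by case=> // /andP[]; rewrite linked_sym; apply: linked_trans.
Qed.

(** A link across the seam can only come from the merged block, since [tensor] has none. *)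
Lemma linked_bulletlr x y : x.2 < pd_order p ->
  linked (bullet p q) x (shift (pd_order p) y) =
  linked p (rightmost p) x && linked q leftmost y.
Proof.
move=> xp; rewrite linked_bullet.
have F z : linked (tensor p q) (rightmost p) (shift (pd_order p) z) = false.
  by apply/negbTE/negP => /linked_tensorlr; rewrite rightmost_lt /= ltnNge leq_addr.
have G : linked (tensor p q) (shift (pd_order p) leftmost) x = false.
  by apply/negbTE/negP => /linked_tensorlr; rewrite xp /= addn0 ltnn.
have H : linked (tensor p q) x (shift (pd_order p) y) = false.
  by apply/negbTE/negP => /linked_tensorlr; rewrite xp ltnNge leq_addr.
by rewrite F G H orbF /= linked_tensorr linked_tensorl ?rightmost_lt.
Qed.

End Bullet.

(** * Cuts and the monoid of diagrams under [tensor] *)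

Lemma shiftP k (x : bool * nat) : x.2 < k \/ exists y, x = shift k y.
Proof.
case: ltnP => h; first by left.
by right; exists (x.1, x.2 - k); rewrite /shift /= subnKC //; case: x h.
Qed.

Lemma shift_shift k m x : shift k (shift m x) = shift (k + m) x.
Proof. by rewrite /shift /= addnA. Qed.

(** No block straddles column [i]. By [cut_tensor] and [cutP], the cuts up to the order of [p] are
    exactly the orders of its left tensor factors. *)
Definition cut (p : pdiagram) (i : nat) : Prop :=
  forall x y, linked p x y -> (x.2 < i) = (y.2 < i).

Lemma cut_tensor p q : cut (tensor p q) (pd_order p).
Proof. by move=> x y /linked_tensorlr. Qed.

(** A cut excludes links between its two sides, so the two restrictions determine [s]. *)
Lemma tensor_unique s p q :
  pd_order s = pd_order p + pd_order q -> cut s (pd_order p) ->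
  (forall x y, x.2 < pd_order p -> y.2 < pd_order p -> linked s x y = linked p x y) ->
  (forall x y, linked s (shift (pd_order p) x) (shift (pd_order p) y) = linked q x y) ->
  s = tensor p q.
Proof.
move=> os cuts sp sq; apply: pdiagramP => // x y.
have cutF t (cutt : cut t (pd_order p)) z w : z.2 < pd_order p ->
  linked t z (shift (pd_order p) w) = false.
  by move=> zp; apply/negbTE/negP => /cutt; rewrite zp ltnNge leq_addr.
case: (shiftP (pd_order p) x) => [xp|[{}x ->]];
  case: (shiftP (pd_order p) y) => [yp|[{}y ->]].
- by rewrite linked_tensorl // sp.
- by rewrite !cutF //; apply: cut_tensor.
- by rewrite ![linked _ _ y]linked_sym !cutF //; apply: cut_tensor.
- by rewrite linked_tensorr sq.
Qed.

Lemma cutP p i : i <= pd_order p -> cut p i ->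
  exists q r, p = tensor q r /\ pd_order q = i.
Proof.
(* The order becomes literally [i + m], so that [shl m] and [shr i] map into the nodes of the
   diagram. *)
case: p => k P; rewrite /pd_order /= => /subnKC ek; move: (k - i) ek => m ek; subst k.
move=> cutp; exists (Tagged diagram (pull (shl m) P)), (Tagged diagram (pull (shr i) P)).
split=> //; apply: tensor_unique => // x y.
- move=> /pos_onto[z <-] /pos_onto[t <-].
  by rewrite (linked_pull (@shl i m)) !pos_shl.
- set r := Tagged diagram (pull (shr i) P).
  have [|nlt] := boolP ((x.2 < pd_order r) && (y.2 < pd_order r)); last first.
    apply/idP/idP => /linked_lt; last by rewrite (negPf nlt).
    by rewrite /= !ltn_add2l (negPf nlt).
  case/andP=> /pos_onto[z <-] /pos_onto[t <-].
  by rewrite (linked_pull (@shr i m)) !pos_shr.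
Qed.

(** The orders of the two sides agree only propositionally, so the blocks are compared through
    [linked]. *)
Lemma tensorA p q r : tensor p (tensor q r) = tensor (tensor p q) r.
Proof.
apply/esym/tensor_unique; rewrite ?order_tensor ?addnA //.
- move=> x y xy; have := linked_tensorlr xy.
  case: (ltnP x.2) => [xlt /esym ylt|]; last first.
    by rewrite order_tensor => le /esym/negbT; rewrite -leqNgt; lia.
  by move: xy; rewrite linked_tensorl // => /linked_tensorlr.
- move=> x y xp yp; rewrite !linked_tensorl //; exact: (leq_trans _ (leq_addr _ _)).
- have lt2 z : z.2 < pd_order q -> (shift (pd_order p) z).2 < pd_order (tensor p q).
    by rewrite order_tensor ltn_add2l.
  have cutF s i z w : cut s i -> z.2 < i -> linked s z (shift i w) = false.
    by move=> cuts zp; apply/negbTE/negP => /cuts; rewrite zp ltnNge leq_addr.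
  move=> x y; case: (shiftP (pd_order q) x) => [xp|[{}x ->]];
    case: (shiftP (pd_order q) y) => [yp|[{}y ->]].
  + by rewrite [LHS]linked_tensorl ?lt2 // linked_tensorr linked_tensorl.
  + rewrite shift_shift -order_tensor !cutF ?lt2 //; exact: cut_tensor.
  + rewrite shift_shift -order_tensor.
    rewrite ![linked _ _ (shift _ y)]linked_sym ![linked _ _ y]linked_sym.
    rewrite !cutF ?lt2 //; exact: cut_tensor.
  + by rewrite !shift_shift -order_tensor !linked_tensorr.
Qed.

Lemma tensor_inj p q p' q' :
  tensor p q = tensor p' q' -> pd_order p = pd_order p' -> p = p' /\ q = q'.
Proof.
move=> e ep; have := congr1 pd_order e; rewrite !order_tensor ep => /addnI eq.
split; apply: pdiagramP => // x y.
  have [/andP[xp yp]|] := boolP ((x.2 < pd_order p) && (y.2 < pd_order p)).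
    by rewrite -(@linked_tensorl p q) // e linked_tensorl -?ep.
  move=> nlt; transitivity false; [|apply/esym]; apply/negbTE; apply: contraNN nlt.
    by move/linked_lt.
  by move/linked_lt; rewrite ep.
by rewrite -(@linked_tensorr p) e ep linked_tensorr.
Qed.

Lemma tensorp0 p : tensor p pd_empty = p.
Proof.
apply/esym/tensor_unique => //; first by rewrite /pd_order /= addn0.
  by move=> x y /linked_lt /andP[-> ->].
move=> x y; apply/idP/idP => /linked_lt.
  by rewrite /= !ltnNge leq_addr.
by rewrite ltn0.
Qed.

Lemma tensor0p p : tensor pd_empty p = p.
Proof. by apply/esym/tensor_unique. 
Qed.

Lemma tensor_eq0 p q : (tensor p q == pd_empty) = (p == pd_empty) && (q == pd_empty).
Proof. by rewrite -!order_eq0 order_tensor addn_eq0. Qed.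

(** Levi's lemma for the monoid of diagrams: the end of the shorter left factor is a cut of the
    longer one. *)
Lemma tensor_levi p q p' q' :
  tensor p q = tensor p' q' -> pd_order p <= pd_order p' ->
  exists t, p' = tensor p t /\ q = tensor t q'.
Proof.
move=> e le; have [|r [t [e' o]]] := cutP le.
  move=> x y xy; have /andP[xp yp] := linked_lt xy.
  have : linked (tensor p q) x y by rewrite e linked_tensorl.
  exact: cut_tensor.
by exists t; move: e; rewrite e' -tensorA => /tensor_inj[] // -> ->.
Qed.

Lemma irreducible_cut p i : irreducible p -> cut p i -> i < pd_order p -> i = 0.
Proof.
move=> irrp cutp ip; have [q [r [e o]]] := cutP (ltnW ip) cutp.
case: (irrp _ _ e) => [q0|r0]; first by rewrite -o q0.
by move: ip; rewrite e order_tensor r0 addn0 o ltnn.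
Qed.

(** * [bullet] as an associative operation on irreducible diagrams *)

Lemma bullet0p p : bullet pd_empty p = p. Proof. by []. Qed.

Lemma bulletp0 p : bullet p pd_empty = p.
Proof.
case: p => [[|k] P] //; apply/eqP; rewrite eq_sym -order_eq0 //.
Qed.

(** A cut left of the seam is a cut of [p], one right of it is a shifted cut of [q], and one at the
    seam would separate the two glued nodes. *)
Lemma irreducible_bullet p q : p != pd_empty -> q != pd_empty ->
  irreducible p -> irreducible q -> irreducible (bullet p q).
Proof.
rewrite -!order_eq0 -!lt0n => p0 q0 irrp irrq r s e.
have cutr : cut (bullet p q) (pd_order r) by rewrite e; apply: cut_tensor.
have os := congr1 pd_order e; rewrite order_bullet order_tensor in os.
have [rp|pr|rp] := ltngtP (pd_order r) (pd_order p).
- left; apply/eqP; rewrite -order_eq0; apply/eqP/(irreducible_cut irrp) => // x y xy.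
  by have /andP[xp yp] := linked_lt xy; apply: cutr; rewrite linked_bulletl.
- have [/eqP|s0] := eqVneq (pd_order s) 0.
    by rewrite order_eq0 => /eqP; right.
  suff : pd_order r - pd_order p = 0 by move/eqP; rewrite subn_eq0 leqNgt pr.
  apply: (irreducible_cut irrq); last by move/eqP: s0; lia.
  move=> x y; rewrite -(linked_bulletr p0 q0) => /cutr /=.
  by rewrite !ltn_subRL.
- have : linked (bullet p q) (rightmost p) (shift (pd_order p) leftmost).
    by rewrite linked_bulletlr ?rightmost_lt // !linked_refl ?rightmost_lt.
  by move/cutr; rewrite rp rightmost_lt // /shift /=; lia.
Qed.

(** Nodes are sorted by the factor they belong to. In either bracketing a link from [p] to [r]
    passes through [q], which must link its leftmost and rightmost lower nodes. *)
Lemma bulletA p q r : p != pd_empty -> q != pd_empty -> r != pd_empty ->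
  bullet p (bullet q r) = bullet (bullet p q) r.
Proof.
rewrite -!order_eq0 -!lt0n => p0 q0 r0.
have pq0 : 0 < pd_order (bullet p q) by rewrite order_bullet addn_gt0 p0.
have qr0 : 0 < pd_order (bullet q r) by rewrite order_bullet addn_gt0 q0.
apply: pdiagramP; first by rewrite !order_bullet addnA.
have rightE : rightmost (bullet p q) = shift (pd_order p) (rightmost q).
  by rewrite /rightmost /shift /= order_bullet; congr (_, _); lia.
have ltl (z : bool * nat) : z.2 < pd_order p -> z.2 < pd_order (bullet p q).
  by rewrite order_bullet => /leq_trans; apply; apply: leq_addr.
have ltm z : z.2 < pd_order q -> (shift (pd_order p) z).2 < pd_order (bullet p q).
  by rewrite order_bullet ltn_add2l.
have shs z : shift (pd_order p) (shift (pd_order q) z) = shift (pd_order (bullet p q)) z.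
  by rewrite shift_shift order_bullet.
have h11 : forall z w, z.2 < pd_order p -> w.2 < pd_order p ->
  linked (bullet p (bullet q r)) z w = linked (bullet (bullet p q) r) z w.
  by move=> z w zp wp; rewrite !linked_bulletl ?ltl.
have h12 : forall z w, z.2 < pd_order p -> w.2 < pd_order q ->
  linked (bullet p (bullet q r)) z (shift (pd_order p) w) =
  linked (bullet (bullet p q) r) z (shift (pd_order p) w).
  move=> z w zp wp; rewrite [RHS]linked_bulletl ?ltm ?ltl //.
  rewrite linked_bulletlr // [linked (bullet q r) _ _]linked_bulletl //.
  by rewrite linked_bulletlr.
have h13 : forall z w, z.2 < pd_order p ->
  linked (bullet p (bullet q r)) z (shift (pd_order p) (shift (pd_order q) w)) =
  linked (bullet (bullet p q) r) z (shift (pd_order p) (shift (pd_order q) w)).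
  move=> z w zp; rewrite shs [RHS]linked_bulletlr ?ltl // rightE -shs.
  rewrite linked_bulletlr // [linked (bullet q r) _ _]linked_bulletlr // andbA.
  congr (_ && _).
  by rewrite [RHS]linked_sym linked_bulletlr // [linked q _ _]linked_sym.
have h22 : forall z w, z.2 < pd_order q -> w.2 < pd_order q ->
  linked (bullet p (bullet q r)) (shift (pd_order p) z) (shift (pd_order p) w) =
  linked (bullet (bullet p q) r) (shift (pd_order p) z) (shift (pd_order p) w).
  move=> z w zq wq; rewrite [RHS]linked_bulletl ?ltm //.
  by rewrite !linked_bulletr // linked_bulletl.
have h23 : forall z w, z.2 < pd_order q ->
  linked (bullet p (bullet q r)) (shift (pd_order p) z)
    (shift (pd_order p) (shift (pd_order q) w)) =
  linked (bullet (bullet p q) r) (shift (pd_order p) z)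
    (shift (pd_order p) (shift (pd_order q) w)).
  move=> z w zq; rewrite linked_bulletr // shs [RHS]linked_bulletlr ?ltm // rightE.
  by rewrite linked_bulletr // linked_bulletlr.
have h33 : forall z w,
  linked (bullet p (bullet q r)) (shift (pd_order p) (shift (pd_order q) z))
     (shift (pd_order p) (shift (pd_order q) w)) =
  linked (bullet (bullet p q) r) (shift (pd_order p) (shift (pd_order q) z))
     (shift (pd_order p) (shift (pd_order q) w)).
  by move=> z w; rewrite !linked_bulletr // !shs linked_bulletr.
have split3 z : [\/ z.2 < pd_order p,
   exists2 w, z = shift (pd_order p) w & w.2 < pd_order q
 | exists w, z = shift (pd_order p) (shift (pd_order q) w)].
  have [|[w ->]] := shiftP (pd_order p) z; first by constructor 1.
  have [|[{}w ->]] := shiftP (pd_order q) w; last by constructor 3; exists w.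
  by constructor 2; exists w.
(* The cases with [x] in a later factor than [y] reduce to the six above by symmetry of [linked]. *)
move=> x y; case: (split3 x) => [xl|[{}x -> xl]|[{}x ->]];
  case: (split3 y) => [yl|[{}y -> yl]|[{}y ->]]; auto;
  rewrite linked_sym [RHS]linked_sym; auto.
Qed.

(** * Unique factorization into irreducible diagrams *)

Lemma factorization_cons a p l : a != pd_empty -> irreducible a ->
  factorization (tensor a p) l <-> exists2 l', l = a :: l' & factorization p l'.
Proof.
move=> a0 irra; split=> [[ll e]|[l' -> [ll ->]]]; last first.
  by split=> // q; rewrite inE => /predU1P[->|/ll].
case: l ll e => [|b l] ll e /=.
  by move/eqP: e; rewrite tensor_eq0 (negPf a0).
have [b0 irrb] := ll b (mem_head _ _).
(* By Levi's lemma the shorter of the two first factors is a left factor of the other;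
   irreducibility leaves an empty remainder. *)
have [ab pl] : a = b /\ p = foldr tensor pd_empty l.
  case: (leqP (pd_order a) (pd_order b)) => [ab|/ltnW ba].
    have [t [eb ->]] := tensor_levi e ab.
    case: (irrb _ _ eb) => [/eqP|t0]; first by rewrite (negPf a0).
    by rewrite t0 tensor0p eb t0 tensorp0.
  have [t [ea eF]] := tensor_levi (esym e) ba.
  case: (irra _ _ ea) => [/eqP|t0]; first by rewrite (negPf b0).
  split; first by rewrite ea t0 tensorp0.
  by apply/esym; rewrite -[RHS]tensor0p -[X in tensor X _]t0; apply: eF.
exists l; first by rewrite ab.
by split=> // q ql; apply: ll; rewrite inE ql orbT.
Qed.

Lemma factorization_nil l : factorization pd_empty l <-> l = [::].
Proof.
split=> [|->]; last by split.
case: l => [//|b l] [ll /= /esym/eqP]; rewrite tensor_eq0 => /andP[b0 _].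
by case: (ll b (mem_head _ _)); rewrite b0.
Qed.

Lemma factorization_exists p : exists l, factorization p l.
Proof.
have [n] := ubnP (pd_order p); elim: n p => // n IH p pn.
have [->|p0] := eqVneq p pd_empty; first by exists [::]; apply/factorization_nil.
have [irrp|/boolp.existsNP[q /boolp.existsNP[r /boolp.not_implyP[e qr]]]] :=
  boolp.pselect (irreducible p).
  exists [:: p]; rewrite -[p in factorization p]tensorp0.
  by apply/factorization_cons => //; exists [::] => //; apply/factorization_nil.
have [q0 r0] : q != pd_empty /\ r != pd_empty.
  by split; apply/eqP => h; apply: qr; [left|right].
have o := congr1 pd_order e; rewrite order_tensor in o.
have oq : pd_order q != 0 by rewrite order_eq0.
have or : pd_order r != 0 by rewrite order_eq0.
have [|s [sl eq]] := IH q; first by move: pn oq or; lia.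
have [|t [tl er]] := IH r; first by move: pn oq or; lia.
exists (s ++ t); split=> [u|]; first by rewrite mem_cat => /orP[/sl|/tl].
rewrite e eq er; elim: (s) => [|a l IHl] /=; first by rewrite tensor0p.
by rewrite -tensorA IHl.
Qed.

(** * Isolation of the upper nodes *)

Lemma upper_isolated_linked p :
  upper_isolated p <-> (forall i y, linked p (true, i) y -> y = (true, i)).
Proof.
split=> [up i y xy|up i].
  have /andP[/= ip /pos_onto[t et]] := linked_lt xy; subst.
  move: xy; have -> : (true, i) = pos (inl (Ordinal ip) : node (pd_order p)) by [].
  rewrite linked_pos (mem_pblockE _ (valP (tagged p)) (up (Ordinal ip))) ?set11 //.
  by rewrite inE => /eqP ->.
have [BP zB] := pblock_block (inl i) (valP (tagged p)).
suff <- : pblock (val (tagged p)) (inl i) = [set inl i] by [].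
apply/setP=> t; rewrite inE -linked_pos; apply/idP/eqP => [/up|->].
  by move/(@pos_inj _ t (inl i)) ->.
exact: linked_refl (pos_lt _).
Qed.

(** Passing to the factors serves the coproduct and the reading of letters; the converse serves
    products and the antipode. *)
Lemma upper_isolated_tensor p q :
  upper_isolated (tensor p q) <-> upper_isolated p /\ upper_isolated q.
Proof.
rewrite !upper_isolated_linked; split=> [up|[up uq] i y xy].
  split=> i y xy.
    have /andP[xp yp] := linked_lt xy.
    by apply: up; rewrite linked_tensorl.
  have := up (shift (pd_order p) (true, i)).2 (shift (pd_order p) y).
  rewrite (linked_tensorr p q (true, i)) => /(_ xy) [+ /addnI].
  by case: (y) => ? ? /= -> ->.
have := linked_tensorlr xy; case: (shiftP (pd_order p) (true, i)) => [xp|[x' e]].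
  by rewrite xp => /esym yp; apply: up; rewrite -(@linked_tensorl p q).
have [yp|[y' ey]] := shiftP (pd_order p) y; first by rewrite e yp ltnNge leq_addr.
move=> _; case: x' e => [[] j] [] // ei; subst y i.
have /uq -> // : linked q (true, j) y'.
by rewrite -(linked_tensorr p q).
Qed.

Lemma upper_isolated_empty : upper_isolated pd_empty.
Proof. by case. Qed.

(** Both gluing points are lower nodes, and an isolated upper node is linked to neither, so it stays
    outside the merged block. *)
Lemma upper_isolated_bullet p q :
  upper_isolated p -> upper_isolated q -> upper_isolated (bullet p q).
Proof.
have [->|p0] := eqVneq p pd_empty; first by rewrite bullet0p.
have [->|q0] := eqVneq q pd_empty; first by rewrite bulletp0.
rewrite -!order_eq0 -!lt0n in p0 q0.
move=> up uq; have /upper_isolated_linked upq : upper_isolated (tensor p q).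
  by apply/upper_isolated_tensor.
apply/upper_isolated_linked => i y; rewrite linked_bullet // => /orP[/upq //|/andP[+ _]].
by rewrite ![linked _ _ (true, i)]linked_sym => /orP[] /upq.
Qed.

Import GRing.Theory.
Local Open Scope ring_scope.

(** * The antipode of a quasi-shuffle algebra *)

Section SplitSum.
Variables (A : Type) (V : zmodType).

Definition splitsum (f : seq A -> seq A -> V) (r : seq A) : V :=
  \sum_(i < (size r).+1) f (take i r) (drop i r).

Lemma splitsum_nil f : splitsum f [::] = f [::] [::].
Proof. by rewrite /splitsum big_ord1. Qed.

Lemma splitsum_cons f x r :
  splitsum f (x :: r) = f [::] (x :: r) + splitsum (fun u v => f (x :: u) v) r.
Proof. by rewrite /splitsum big_ord_recl. Qed.

Lemma splitsum_rcons f r x :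
  splitsum f (rcons r x) = splitsum (fun u v => f u (rcons v x)) r + f (rcons r x) [::].
Proof.
rewrite /splitsum size_rcons big_ord_recr /=; congr (_ + _).
  apply: eq_bigr => i _; have ir : (i <= size r)%N by rewrite -ltnS.
  rewrite -cats1 takel_cat // drop_cat; case: ltnP => [_|ri]; first by rewrite cats1.
  have -> : (i : nat) = size r by apply/eqP; rewrite eqn_leq ir ri.
  by rewrite subnn drop_size.
by rewrite -(size_rcons r x) take_size drop_size.
Qed.

(** Passes between a word and its reversal, on which the antipode recursion runs. *)
Lemma splitsum_rev f r : splitsum f (rev r) = splitsum (fun u v => f (rev v) (rev u)) r.
Proof.
elim: r f => [|x r IH] f; first by rewrite !splitsum_nil.
rewrite rev_cons splitsum_rcons IH splitsum_cons addrC -rev_cons; congr (_ + _).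
by apply: eq_bigr => i _; rewrite rev_cons.
Qed.

Lemma eq_splitsum f g r : f =2 g -> splitsum f r = splitsum g r.
Proof. by move=> fg; apply: eq_bigr => i _; rewrite fg. Qed.

Lemma splitsumB f g r :
  splitsum (fun u v => f u v - g u v) r = splitsum f r - splitsum g r.
Proof. by rewrite /splitsum sumrB. Qed.

Lemma splitsum_morph (h : {additive V -> V}) f r :
  splitsum (fun u v => h (f u v)) r = h (splitsum f r).
Proof. by rewrite /splitsum raddf_sum. Qed.

End SplitSum.

(** * Quasi-shuffle products and the antipode recursion *)

Section QuasiShuffle.
Variables (A : Type) (op : A -> A -> A) (V : zmodType).
Hypothesis opA : associative op.

(* The signed sum, over all splittings [r = u ++ s], of [c a (H s)], where [a] is
   the product of the letters of [rev u] and of [b]: words are stored reversed, so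
   the block being built grows to the left. *)
Fixpoint blocks (c : A -> V -> V) (H : seq A -> V) (b : A) (r : seq A) : V :=
  match r with
  | [::] => c b (H [::])
  | x :: r' => c b (H r) - blocks c H (op x b) r'
  end.

(** Only suffixes of [r] are ever passed to [H]; this form suits an induction on the size of
    words. *)
Lemma eq_blocks c H1 H2 b r :
  (forall s, (size s <= size r)%N -> H1 s = H2 s) -> blocks c H1 b r = blocks c H2 b r.
Proof.
elim: r b => [|x r IH] b h /=; first by rewrite h.
by rewrite h // IH // => s sr; rewrite h // (leq_trans sr) //=.
Qed.

Variable c : A -> {additive V -> V}.
Variable one : V.
Variable mul : V -> V -> V.
Hypothesis mul1 : forall x, mul one x = x.
Hypothesis mulr1 : forall x, mul x one = x.
Hypothesis mulDl : forall x y z, mul (x + y) z = mul x z + mul y z.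
Hypothesis mulDr : forall x y z, mul x (y + z) = mul x y + mul x z.
Hypothesis mul_letter : forall a b x y,
  mul (c a x) (c b y) =
  c a (mul x (c b y)) + c b (mul (c a x) y) + c (op a b) (mul x y).

Lemma mulNl x y : mul (- x) y = - mul x y.
Proof.
have m0 : mul 0 y = 0 by apply: (addIr (mul 0 y)); rewrite -mulDl !add0r.
by apply: (addIr (mul x y)); rewrite -mulDl !addNr.
Qed.

Lemma mulNr x y : mul x (- y) = - mul x y.
Proof.
have m0 : mul x 0 = 0 by apply: (addIr (mul x 0)); rewrite -mulDr !add0r.
by apply: (addIr (mul x y)); rewrite -mulDr !addNr.
Qed.

(* The antipode of the word [rev r] is [antipode_word r] below; unfolding it inside
   [blocks] is what makes the recursion structural. *)
Fixpoint antipode_blocks (b : A) (r : seq A) : V :=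
  match r with
  | [::] => c b one
  | x :: r' => c b (- antipode_blocks x r') - antipode_blocks (op x b) r'
  end.

Definition antipode_word (r : seq A) : V :=
  if r is x :: r' then - antipode_blocks x r' else one.

Lemma antipode_blocksE b r : antipode_blocks b r = blocks c antipode_word b r.
Proof. by elim: r b => //= x r IH b; rewrite -IH. Qed.

(** The block ending at the last letter [x] of the word [rev (x :: r)] is split off and becomes the
    first letter of each term. *)
Lemma antipode_word_cons x r : antipode_word (x :: r) = - blocks c antipode_word x r.
Proof. by rewrite /= antipode_blocksE. Qed.

(** The counit of a word times [one], the required value of both convolutions. *)
Definition delta (r : seq A) : V := if r is [::] then one else 0.

Definition word (s : seq A) : V := foldr (fun a => c a) one s.

(** * The antipode as a left convolution inverse *)

Notation S := antipode_word.

(** The recursion [mul_letter], summed over the splittings of [r]. Associativity of [op] lets [b] be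
    attached to the right end of a block that grows on the left. *)
Lemma blocks_mul_letter a b y r :
  mul (blocks c S a r) (c b y) =
  blocks c (fun s => mul (S s) (c b y)) a r + c b (mul (blocks c S a r) y)
  + blocks c (fun s => mul (S s) y) (op a b) r.
Proof.
elim: r a => [|x r IH] a; first by rewrite /= mul_letter.
rewrite [blocks c S a (x :: r)]/= !mulDl !mulNl mul_letter IH raddfB /= opA.
by rewrite !opprD [LHS]addrACA [X in X + _ = _]addrACA.
Qed.

(** Write $T(b,y,r)$ for [blocks c (fun s => mul (S s) y) b r]. The right side is $T(b,y,xr)-T(x,c_b
    y,r)$, a difference of consecutive terms of a telescope. *)
Lemma antipode_mul_letter x r b y :
  mul (S (x :: r)) (c b y) =
  blocks c (fun s => mul (S s) y) b (x :: r) - blocks c (fun s => mul (S s) (c b y)) x r.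
Proof.
rewrite antipode_word_cons mulNl blocks_mul_letter /= antipode_blocksE mulNl raddfN /=.
by rewrite !opprD [RHS]addrC addrA.
Qed.

(** Moving the next letter from the argument of [S] to the word cancels the negative term of
    [antipode_mul_letter], and only the first positive term survives. *)
Lemma antipode_left_telescope b v r :
  splitsum (fun u s => mul (S s) (word (rev u ++ b :: v))) r =
  blocks c (fun s => mul (S s) (word v)) b r.
Proof.
elim: r b v => [|x r IH] b v; first by rewrite splitsum_nil /= !mul1.
rewrite splitsum_cons [rev [::] ++ _]/= [word (b :: v)]/= antipode_mul_letter.
under eq_splitsum => u s do rewrite rev_cons cat_rcons.
by rewrite IH subrK.
Qed.

Lemma antipode_left r :
  splitsum (fun u s => mul (S s) (word (rev u))) r = delta r.
Proof.
case: r => [|x r]; first by rewrite splitsum_nil /= !mul1.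
rewrite splitsum_cons /= mulr1 antipode_blocksE.
under eq_splitsum => u s do rewrite rev_cons -cats1.
(* The splitting with empty [u] gives minus a [blocks] term; all the others telescope to that same
   term. *)
by rewrite antipode_left_telescope (@eq_blocks _ _ S) ?addNr // => s _ /=.
Qed.

(** * The antipode as a right convolution inverse *)

Lemma letter_mul_blocks a b y r :
  mul (c a y) (blocks c S b r) =
  c a (mul y (blocks c S b r)) + blocks c (fun s => mul (c a y) (S s)) b r
  + blocks (fun z => c (op a z)) (fun s => mul y (S s)) b r.
Proof.
elim: r b => [|x r IH] b; first by rewrite /= mul_letter.
rewrite [blocks c S b (x :: r)]/= !mulDr !mulNr mul_letter IH raddfB /=.
by rewrite !opprD [LHS]addrACA [X in X + _ = _]addrACA.
Qed.

(** Both sides run over the cuts of [r] into three consecutive words: the one fused into the block,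
    then the two arguments of [h]. *)
Lemma splitsum_blocks (d : A -> {additive V -> V}) (h : seq A -> seq A -> V) b r :
  splitsum (fun u v => blocks d (fun s => h s v) b u) r = blocks d (splitsum h) b r.
Proof.
elim: r b h => [|x r IH] b h; first by rewrite /= !splitsum_nil.
by rewrite splitsum_cons /= splitsumB splitsum_morph IH splitsum_cons raddfD addrA.
Qed.

Definition right_conv (r : seq A) : V :=
  splitsum (fun u s => mul (word (rev s)) (S u)) r.

(** The terms of [right_conv (rcons r a)] whose left factor is a non-empty word, which then begins
    with [a]. *)
Let right_conv_letter a r :=
  splitsum (fun u s => mul (c a (word (rev s))) (S u)) r.

Lemma right_conv_rcons r a :
  right_conv (rcons r a) = S (rcons r a) + right_conv_letter a r.
Proof.
rewrite /right_conv splitsum_rcons addrC [word (rev [::])]/= mul1.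
by under eq_splitsum => u s do rewrite rev_rcons.
Qed.

Lemma right_conv_letter_cons a x r :
  right_conv_letter a (x :: r) =
  c a (right_conv (x :: r)) - blocks c (right_conv_letter a) x r
  - blocks (fun z => c (op a z)) right_conv x r.
Proof.
(* Each [S u] with [u] non-empty is expanded by [letter_mul_blocks]; for empty [u] there is nothing
   to expand, hence the 0. *)
have e : right_conv_letter a (x :: r) =
    splitsum (fun u s => c a (mul (word (rev s)) (S u)) -
      (if u is y :: u' then
         blocks c (fun t => mul (c a (word (rev s))) (S t)) y u' +
         blocks (fun z => c (op a z)) (fun t => mul (word (rev s)) (S t)) y u'
       else 0)) (x :: r).
  apply: eq_splitsum => -[|y u] s; first by rewrite !mulr1 subr0.
  rewrite antipode_word_cons !mulNr letter_mul_blocks raddfN.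
  by rewrite -addrA opprD.
rewrite e splitsumB splitsum_morph -addrA -opprD; congr (_ - _).
rewrite splitsum_cons add0r /splitsum big_split /=; congr (_ + _).
  exact: splitsum_blocks.
exact: splitsum_blocks.
Qed.

(** The second term is the splitting in which the block absorbs the whole word, [a] included;
    [delta] selects it. *)
Lemma blocks_rcons b a r :
  blocks c S b (rcons r a) =
  blocks c (fun s => S (rcons s a)) b r - blocks (fun z => c (op a z)) delta b r.
Proof.
elim: r b => [|x r IH] b; first by rewrite /=.
rewrite rcons_cons [LHS]/= [in RHS]/= IH raddf0 sub0r.
by rewrite !opprD !opprK addrA.
Qed.

(** Strong induction on the size. For shorter words the claim turns [right_conv] into [delta] and
    [right_conv_letter a s] into [- S (rcons s a)]; then [blocks_rcons] reassembles [- S] of the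
    full word, which cancels the first term of [right_conv_rcons]. *)
Lemma antipode_right r : right_conv r = delta r.
Proof.
have [n] := ubnP (size r); elim: n r => // n IH r.
case/lastP: r => [|r a]; first by rewrite /right_conv splitsum_nil /= mul1.
rewrite size_rcons ltnS => rn; rewrite right_conv_rcons.
have -> : delta (rcons r a) = 0 by case: (r).
have Ka s : (size s < size r)%N -> right_conv_letter a s = - S (rcons s a).
  move=> sr; apply/eqP; rewrite -addr_eq0 addrC -right_conv_rcons IH.
    by case: (s).
  by rewrite size_rcons (leq_ltn_trans sr).
case: r rn Ka => [|x r] rn Ka.
  by rewrite /right_conv_letter splitsum_nil /= mulr1 addNr.
rewrite right_conv_letter_cons IH //= raddf0 sub0r.
have -> : blocks c (right_conv_letter a) x r = - blocks c (fun s => S (rcons s a)) x r.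
  rewrite (@eq_blocks _ _ (fun s => - S (rcons s a))); last by move=> s; apply: Ka.
  elim: (r) (x) => [|y q IHq] z; rewrite /= raddfN //.
  by rewrite IHq opprB opprK addrC.
rewrite (@eq_blocks _ right_conv delta); last first.
  by move=> s sr; apply: IH; rewrite (leq_ltn_trans sr) // ltnW.
by rewrite opprK antipode_blocksE blocks_rcons addNr.
Qed.
End QuasiShuffle.

From mathcomp Require Import finmap.
From mathcomp Require Import boolp classical_sets cardinality fsbigop.
From mathcomp Require Import monalg.

Local Open Scope classical_set_scope.

(** * ParQSym as a quasi-shuffle algebra *)

Section LinearExtension.
Variables (K : fieldType) (B : choiceType).

Lemma malg_ind (P : {malg K[B]} -> Prop) :
  P 0 -> (forall a b x, P x -> P (a *: << b >> + x)) -> forall x, P x.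
Proof.
move=> P0 PD x; rewrite [x]monalgE; elim: (enum_fset (msupp x)) => [|b s IH].
  by rewrite big_nil.
rewrite big_cons.
have -> : << x@_b *g b >> = x@_b *: << b >> :> {malg K[B]}.
  by apply/malgP => k; rewrite mcoeffZ !mcoeffU mulrnAr mulr1.
exact: PD.
Qed.

Variable V : lmodType K.
Implicit Types (f : B -> V) (x : {malg K[B]}).

Lemma lin_ext_is_linear f : linear (lin_ext f).
Proof.
(* The sum may run over any finite set containing the support, so three elements can share one index
   set. *)
have E x (d : {fset B}) :
    (msupp x `<=` d)%fset -> lin_ext f x = \sum_(b <- d) x@_b *: f b.
  move=> xd; apply: big_fset_incl => // b _ bx.
  by rewrite mcoeff_outdom // scale0r.
move=> a x y; pose d := (msupp x `|` msupp y `|` msupp (a *: x + y))%fset.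
rewrite !(E _ d); try by apply/fsubsetP => k; rewrite !in_fsetU => ->; rewrite ?orbT.
rewrite scaler_sumr -big_split; apply: eq_bigr => b _ /=.
by rewrite mcoeffD mcoeffZ scalerDl scalerA.
Qed.

HB.instance Definition _ f :=
  GRing.isLinear.Build K {malg K[B]} V _ (lin_ext f) (lin_ext_is_linear f).

Lemma lin_extU f b : lin_ext f << b >> = f b.
Proof. by rewrite /lin_ext msuppU oner_eq0 big_seq_fset1 mcoeffUU scale1r. Qed.

Lemma malg_eq_linear (f g : {malg K[B]} -> V) :
  linear f -> linear g -> (forall b, f << b >> = g << b >>) -> f =1 g.
Proof.
have linear0 (h : {malg K[B]} -> V) : linear h -> h 0 = 0.
  by move=> lh; have := lh (-1) 0 0; rewrite scaler0 addr0 scaleN1r addNr.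
move=> lf lg fg; elim/malg_ind => [|a b x IH]; first by rewrite !linear0.
by rewrite lf lg fg IH.
Qed.

End LinearExtension.

(** Finiteness of [D] keeps both sums away from the default value 0 of a sum with infinite
    support. *)
Lemma raddf_fsbig (U V : zmodType) (I : choiceType) (h : {additive U -> V})
    (D : set I) (F : I -> U) :
  finite_set D -> h (\sum_(i \in D) F i) = \sum_(i \in D) h (F i).
Proof. by move=> finD; rewrite !fsbig_finite // raddf_sum. Qed.

Lemma fsum_image (V : zmodType) (I J : choiceType) (D : set I) (h : I -> J) (F : J -> V) :
  injective h -> \sum_(j \in h @` D) F j = \sum_(i \in D) F (h i).
Proof. by move=> hI; apply: fsbig_image => x y _ _ /hI. Qed.

(** * Diagrams as words in irreducible letters *)

Definition is_letter (p : pdiagram) : bool := `[< p != pd_empty /\ irreducible p >].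

(** The classical Boolean form of irreducibility makes the letters a subtype, which inherits
    equality and choice. *)
Definition letter : Type := {p : pdiagram | is_letter p}.
HB.instance Definition _ := SubType.on letter.
HB.instance Definition _ := Choice.on letter.

Lemma letterP (a : letter) : val a != pd_empty /\ irreducible (val a).
Proof. exact/asboolP/(valP a). Qed.

Lemma letter_neq0 (a : letter) : val a != pd_empty.
Proof. by case: (letterP a). Qed.

Lemma is_letter_bullet (a b : letter) : is_letter (bullet (val a) (val b)).
Proof.
have [[a0 irra] [b0 irrb]] := (letterP a, letterP b); apply/asboolP; split.
  by rewrite -order_eq0 order_bullet addn_eq0 order_eq0 (negPf a0).
exact: irreducible_bullet.
Qed.

Definition letter_bullet (a b : letter) : letter :=
  exist (fun p => is_letter p) _ (is_letter_bullet a b).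

Lemma letter_bulletA : associative letter_bullet.
Proof. by move=> a b c; apply: val_inj; apply: bulletA; apply: letter_neq0. Qed.

Definition tensor_word (w : seq letter) : pdiagram := foldr tensor pd_empty (map val w).

Lemma factorization_letter (a : letter) p l :
  factorization (tensor (val a) p) l <-> exists2 l', l = val a :: l' & factorization p l'.
Proof. by case: (letterP a) => a0 irra; apply: factorization_cons. Qed.

(** Freeness of the monoid of diagrams on the letters. *)
Lemma factorization_word w l : factorization (tensor_word w) l <-> l = map val w.
Proof.
elim: w l => [|a w IH] l; first exact: factorization_nil.
rewrite [tensor_word _]/= factorization_letter; split=> [[l' -> /IH ->] //|->].
by exists (map val w) => //; apply/IH.
Qed.

Lemma tensor_word_inj : injective tensor_word.
Proof.
move=> v w e; apply: (inj_map val_inj).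
by apply/factorization_word; rewrite -e; apply/factorization_word.
Qed.

Lemma tensor_word_onto p : exists w, tensor_word w = p.
Proof.
have [l [ll ->]] := factorization_exists p.
elim: l ll => [|q l IH] ll; first by exists [::].
have [w ew] : exists w, tensor_word w = foldr tensor pd_empty l.
  by apply: IH => r rl; apply: ll; rewrite inE rl orbT.
have lq : is_letter q by apply/asboolP/ll/mem_head.
by exists (exist (fun p => is_letter p) q lq :: w); rewrite /= -ew.
Qed.

(** The choice of a preimage is immaterial, since [tensor_word] is injective. *)
Definition letters (p : pdiagram) : seq letter := projT1 (cid (tensor_word_onto p)).

Lemma lettersK : cancel letters tensor_word.
Proof. by move=> p; rewrite /letters; case: cid. Qed.

Lemma tensor_wordK : cancel tensor_word letters.
Proof. by move=> w; apply: tensor_word_inj; rewrite lettersK. Qed.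

(** * Index sets of the product and of the coproduct *)

Arguments nonempty_entries : simpl never.

Lemma nonempty_entries_cons p s :
  nonempty_entries (p :: s) =
  if p == pd_empty then nonempty_entries s else p :: nonempty_entries s.
Proof. by rewrite /nonempty_entries /= if_neg. Qed.

Lemma bullet_eq0 p q : (bullet p q == pd_empty) = (p == pd_empty) && (q == pd_empty).
Proof. by rewrite -!order_eq0 order_bullet addn_eq0. Qed.

(** The first pair of a padding holds [a], [b] or both, as a pair of empty diagrams is excluded.
    These are the three terms of the quasi-shuffle recursion. *)
Lemma paddings_cons (a b : letter) p q :
  paddings (tensor (val a) p) (tensor (val b) q) =
  cons (val a, pd_empty) @` paddings p (tensor (val b) q) `|`
  (cons (pd_empty, val b) @` paddings (tensor (val a) p) q `|`
   cons (val a, val b) @` paddings p q).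
Proof.
have [a0 b0] := (negPf (letter_neq0 a), negPf (letter_neq0 b)).
apply/seteqP; split=> [s|s].
  case: s => [|[t1 t2] s] [/= + /= + ne] => f1 f2.
    by case/factorization_letter: f1.
  have ne' t : t \in s -> bullet t.1 t.2 != pd_empty.
    by move=> ts; apply: ne; rewrite inE ts orbT.
  have := ne _ (mem_head _ _); rewrite bullet_eq0 /=.
  rewrite !nonempty_entries_cons in f1 f2.
  have [e1|n1] := eqVneq t1 pd_empty; have [e2|n2] := eqVneq t2 pd_empty => // _.
  - right; left; rewrite e1 eqxx (negPf n2) in f1 f2 *.
    by have /factorization_letter[l [-> <-] fl] := f2; exists s.
  - left; rewrite e2 eqxx (negPf n1) in f1 f2 *.
    by have /factorization_letter[l [-> <-] fl] := f1; exists s.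
  - right; right; rewrite (negPf n1) (negPf n2) in f1 f2.
    have /factorization_letter[l [-> el] fl] := f1.
    have /factorization_letter[l' [-> el'] fl'] := f2.
    by exists s => //; split; rewrite ?el ?el'.
have cons_ne (t : pdiagram * pdiagram) s' : bullet t.1 t.2 != pd_empty ->
    (forall u, u \in s' -> bullet u.1 u.2 != pd_empty) ->
    forall u, u \in t :: s' -> bullet u.1 u.2 != pd_empty.
  by move=> tn sn u; rewrite inE => /predU1P[->|/sn].
case=> [|[]] [s' [f1 f2 ne] <-]; split; rewrite /= ?nonempty_entries_cons ?eqxx ?a0 ?b0 //;
  try by apply/factorization_letter; eexists.
- by apply: cons_ne; rewrite // bullet_eq0 a0.
- by apply: cons_ne; rewrite // bullet_eq0 b0 andbF.
- by apply: cons_ne; rewrite // bullet_eq0 a0.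
Qed.

(** All left entries are empty, so every right entry must be a letter of [q]. *)
Lemma paddings_emptyl q : exists2 s, paddings pd_empty q = [set s] &
  foldr tensor pd_empty [seq bullet t.1 t.2 | t <- s] = q.
Proof.
rewrite -(lettersK q); move: (letters q) => w.
exists [seq (pd_empty, val a) | a : letter <- w]; last first.
  by rewrite -map_comp.
apply/seteqP; split=> [s [/factorization_nil f1 /factorization_word f2 ne]|_ ->] /=; last first.
  split; [apply/factorization_nil | apply/factorization_word|].
  - by elim: w => // a w IH; rewrite /= nonempty_entries_cons eqxx.
  - by elim: w => //= a w IH; rewrite nonempty_entries_cons (negPf (letter_neq0 a)) IH.
  - by move=> _ /mapP[a _ ->]; rewrite bullet_eq0 (negPf (letter_neq0 a)) andbF.
elim: s w f1 f2 ne => [|[t1 t2] s IH] [|a w] //= f1 f2 ne;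
  rewrite !nonempty_entries_cons in f1 f2.
  have := ne _ (mem_head _ _); rewrite bullet_eq0 /=.
  by move: f1 f2; case: eqP => // _ _; case: eqP.
have := ne _ (mem_head _ _); rewrite bullet_eq0 /=.
move: f1 f2; case: eqP => // -> f1; case: eqP => //= _ [-> f2] _.
by rewrite (IH w) // => t ts; apply: ne; rewrite inE ts orbT.
Qed.

Lemma paddings_emptyr p : exists2 s, paddings p pd_empty = [set s] &
  foldr tensor pd_empty [seq bullet t.1 t.2 | t <- s] = p.
Proof.
rewrite -(lettersK p); move: (letters p) => w.
exists [seq (val a, pd_empty) | a : letter <- w]; last first.
  by rewrite -map_comp /tensor_word; congr foldr; apply: eq_map => a; rewrite /= bulletp0.
apply/seteqP; split=> [s [/factorization_word f1 /factorization_nil f2 ne]|_ ->] /=; last first.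
  split; [apply/factorization_word | apply/factorization_nil|].
  - by elim: w => //= a w IH; rewrite nonempty_entries_cons (negPf (letter_neq0 a)) IH.
  - by elim: w => // a w IH; rewrite /= nonempty_entries_cons eqxx.
  - by move=> _ /mapP[a _ ->]; rewrite bullet_eq0 (negPf (letter_neq0 a)).
elim: s w f1 f2 ne => [|[t1 t2] s IH] [|a w] //= f1 f2 ne;
  rewrite !nonempty_entries_cons in f1 f2.
  have := ne _ (mem_head _ _); rewrite bullet_eq0 /=.
  by move: f2 f1; case: eqP => // _ _; case: eqP.
have := ne _ (mem_head _ _); rewrite bullet_eq0 /=.
move: f2 f1; case: eqP => // -> f2; case: eqP => //= _ [-> f1] _.
by rewrite (IH w) // => t ts; apply: ne; rewrite inE ts orbT.
Qed.

(** By Levi's lemma and irreducibility of [a], a non-empty left factor begins with [a]. *)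
Lemma deconcatenations_cons (a : letter) p :
  deconcatenations (tensor (val a) p) =
  [set (pd_empty, tensor (val a) p)] `|`
  (fun t => (tensor (val a) t.1, t.2)) @` deconcatenations p.
Proof.
apply/seteqP; split=> [[q r]|t]; last first.
  case=> [->|[[q r] /= e <-]]; first exact: tensor0p.
  by rewrite /deconcatenations /= -tensorA e.
rewrite {1}/deconcatenations /= => e.
have [q0|q0] := eqVneq q pd_empty; first by left; rewrite -e q0 tensor0p.
right; have [a0 irra] := letterP a.
have [aq|/ltnW qa] := leqP (pd_order (val a)) (pd_order q).
  by have [t [-> ->]] := tensor_levi (esym e) aq; exists (t, r).
have [t [ea er]] := tensor_levi e qa.
case: (irra _ _ ea) => [/eqP|t0]; first by rewrite (negPf q0).
exists (pd_empty, p); first by rewrite /deconcatenations /= tensor0p.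
by rewrite ea er t0 !(tensor0p, tensorp0).
Qed.

Lemma deconcatenations_empty : deconcatenations pd_empty = [set (pd_empty, pd_empty)].
Proof.
apply/seteqP; split=> [[q r]|_ ->]; last exact: tensor0p.
by rewrite {1}/deconcatenations /= => /eqP; rewrite tensor_eq0 => /andP[/eqP -> /eqP ->].
Qed.

Lemma sum_deconcatenations (V : zmodType) (F : pdiagram * pdiagram -> V) w :
  \sum_(t \in deconcatenations (tensor_word w)) F t =
  splitsum (fun u v => F (tensor_word u, tensor_word v)) w.
Proof.
elim: w F => [|a w IH] F; first by rewrite deconcatenations_empty fsbig_set1 splitsum_nil.
rewrite deconcatenations_cons fsbigU0.
- rewrite fsbig_set1 fsum_image ?IH ?splitsum_cons //.
  move=> [q r] [q' r'] e; have [//|_ eq] := tensor_inj (congr1 fst e).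
  by rewrite (eq : q = q') (congr1 snd e : r = r').
- exact: finite_set1.
- exact/finite_image/finite_deconcatenations.
- move=> _ [-> [[q r] _ /(congr1 fst)/eqP]] /=.
  by rewrite tensor_eq0 (negPf (letter_neq0 a)).
Qed.

(** * The product and the antipode in terms of letters *)

Section ParQSym.
Variable K : fieldType.
Implicit Types x y z : ParQSym K.

(** The operator $L_a$ of the quasi-shuffle recursion. *)
Definition tensor_letter (a : letter) : ParQSym K -> ParQSym K :=
  lin_ext (fun p => M K (tensor (val a) p)).
HB.instance Definition _ a := GRing.Linear.on (tensor_letter a).

Lemma tensor_letterM a p : tensor_letter a (M K p) = M K (tensor (val a) p).
Proof. exact: lin_extU. Qed.

Lemma tensor_letterP a k x y :
  tensor_letter a (k *: x + y) = k *: tensor_letter a x + tensor_letter a y.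
Proof. exact: linearP. Qed.

Lemma pqs_mulM_letter (a b : letter) p q :
  pqs_mulM K (tensor (val a) p) (tensor (val b) q) =
  tensor_letter a (pqs_mulM K p (tensor (val b) q)) +
  tensor_letter b (pqs_mulM K (tensor (val a) p) q) +
  tensor_letter (letter_bullet a b) (pqs_mulM K p q).
Proof.
have [a0 b0] := (negPf (letter_neq0 a), negPf (letter_neq0 b)).
have consI (t : pdiagram * pdiagram) : injective (cons t) by move=> ? ? [].
rewrite /pqs_mulM paddings_cons fsbigU0; first last.
- move=> _ [[s _ <-]] [[s' _ [/esym/eqP]]|[s' _ [/eqP]]]; by rewrite ?a0 ?b0.
- rewrite finite_setU; split; exact/finite_image/finite_paddings.
- exact/finite_image/finite_paddings.
rewrite fsbigU0; first last.
- by move=> _ [[s _ <-]] [s' _ [/eqP]]; rewrite a0.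
- exact/finite_image/finite_paddings.
- exact/finite_image/finite_paddings.
(* Prefixing the pair [t] to a padding tensors the resulting diagram on the left with the letter
   [bullet t.1 t.2]. *)
have sum_cons (t : pdiagram * pdiagram) (d : letter) p' q' :
    bullet t.1 t.2 = val d ->
    \sum_(s \in cons t @` paddings p' q')
       M K (foldr tensor pd_empty [seq bullet t.1 t.2 | t <- s]) =
    tensor_letter d (\sum_(s \in paddings p' q')
       M K (foldr tensor pd_empty [seq bullet t.1 t.2 | t <- s])).
  move=> td; rewrite (raddf_fsbig (tensor_letter d)); last exact: finite_paddings.
  apply: (etrans (fsum_image _ _ (consI t))); apply: eq_fsbigr => s _.
  by rewrite /= tensor_letterM td.
rewrite (sum_cons _ a) ?bulletp0 // (sum_cons _ b) //.
by rewrite (sum_cons _ (letter_bullet a b)) //; exact: addrA.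
Qed.

Lemma pqs_mulMM p q : pqs_mul (M K p) (M K q) = pqs_mulM K p q.
Proof. by rewrite /pqs_mul /M !lin_extU. Qed.

Lemma pqs_mul_linearr x : linear (pqs_mul x).
Proof.
move=> a y z; rewrite /pqs_mul /lin_ext scaler_sumr -big_split /=.
apply: eq_bigr => p _; rewrite scalerA mulrC -scalerA -scalerDr; congr (_ *: _).
exact: (linearP (lin_ext (pqs_mulM K p))).
Qed.

HB.instance Definition _ x :=
  GRing.isLinear.Build K _ _ _ (pqs_mul x) (pqs_mul_linearr x).

Lemma pqs_mulPr z k x y : pqs_mul z (k *: x + y) = k *: pqs_mul z x + pqs_mul z y.
Proof. exact: linearP. Qed.

Lemma pqs_mulDl x y z : pqs_mul (x + y) z = pqs_mul x z + pqs_mul y z.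
Proof. exact: linearD. Qed.

Lemma pqs_mulZl a x z : pqs_mul (a *: x) z = a *: pqs_mul x z.
Proof. exact: linearZ. Qed.

Lemma pqs_mul0l z : pqs_mul 0 z = 0.
Proof. exact: linear0. Qed.

Lemma pqs_mul1l : left_id (pqs_one K) (@pqs_mul K).
Proof.
elim/malg_ind => [|a p x IH]; first by rewrite linear0.
rewrite linearP /= IH pqs_mulMM; congr (_ *: _ + _).
by rewrite /pqs_mulM; case: (paddings_emptyl p) => s -> e; rewrite fsbig_set1 e.
Qed.

Lemma pqs_mul1r : right_id (pqs_one K) (@pqs_mul K).
Proof.
elim/malg_ind => [|a p x IH]; first by rewrite pqs_mul0l.
rewrite pqs_mulDl pqs_mulZl IH pqs_mulMM; congr (_ *: _ + _).
by rewrite /pqs_mulM; case: (paddings_emptyr p) => s -> e; rewrite fsbig_set1 e.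
Qed.

Lemma pqs_mul_letter a b x y :
  pqs_mul (tensor_letter a x) (tensor_letter b y) =
  tensor_letter a (pqs_mul x (tensor_letter b y)) +
  tensor_letter b (pqs_mul (tensor_letter a x) y) +
  tensor_letter (letter_bullet a b) (pqs_mul x y).
Proof.
elim/malg_ind: x => [|k p x IHx]; first by rewrite !(linear0, pqs_mul0l) !addr0.
rewrite !(tensor_letterP, pqs_mulDl, pqs_mulZl) IHx; clear IHx.
(* By linearity it remains to treat a basis element on the left; the same reduction is then made in
   [y]. *)
suff -> : pqs_mul (tensor_letter a (M K p)) (tensor_letter b y) =
    tensor_letter a (pqs_mul (M K p) (tensor_letter b y)) +
    tensor_letter b (pqs_mul (tensor_letter a (M K p)) y) +
    tensor_letter (letter_bullet a b) (pqs_mul (M K p) y).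
  by rewrite !scalerDr [LHS]addrACA [X in X + _ = _]addrACA.
elim/malg_ind: y => [|l q y IHy]; first by rewrite !linear0 !addr0.
rewrite !(tensor_letterP, pqs_mulPr) IHy.
rewrite -/(M K q).
have := pqs_mulM_letter a b p q; rewrite -!pqs_mulMM -!tensor_letterM => ->.
by rewrite !scalerDr [LHS]addrACA [X in X + _ = _]addrACA.
Qed.

Lemma word_tensor_word w : word tensor_letter (pqs_one K) w = M K (tensor_word w).
Proof.
elim: w => [//|a w IH].
exact: (etrans (congr1 (tensor_letter a) IH) (tensor_letterM a _)).
Qed.

Definition antipode_rev : seq letter -> ParQSym K :=
  antipode_word letter_bullet tensor_letter (pqs_one K).

Definition antipode : ParQSym K -> ParQSym K :=
  lin_ext (fun p => antipode_rev (rev (letters p))).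
HB.instance Definition _ := GRing.Linear.on antipode.

Lemma antipode_tensor_word w : antipode (M K (tensor_word w)) = antipode_rev (rev w).
Proof. by rewrite /antipode /M lin_extU tensor_wordK. Qed.

Lemma tens_M p q : tens (M K p) (M K q) = << (p, q) >>.
Proof. by rewrite /tens /M !lin_extU. Qed.

(** The maps [f] and [g] enter only through their values on basis elements, which [lin_ext] extends
    linearly. *)
Lemma convolution_linear f g : linear (@convolution K f g).
Proof. by move=> a x y; rewrite /convolution /pqs_comul !linearP. Qed.

Lemma convolution_word f g w :
  convolution f g (M K (tensor_word w)) =
  splitsum (fun u v => pqs_mul (f (M K (tensor_word u))) (g (M K (tensor_word v)))) w.
Proof.
rewrite /convolution /pqs_comul [X in lin_ext _ X]lin_extU /pqs_comulM.
rewrite raddf_fsbig; last exact: finite_deconcatenations.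
rewrite -(sum_deconcatenations (fun t => pqs_mul (f (M K t.1)) (g (M K t.2)))).
by apply: eq_fsbigr => t _; rewrite tens_M; apply: lin_extU.
Qed.

Lemma tensor_word_eq0 w : (tensor_word w == pd_empty) = (w == [::]).
Proof. by rewrite -(inj_eq tensor_word_inj). Qed.

Lemma antipodeP : is_antipode (antipode : {linear ParQSym K -> ParQSym K}).
Proof.
have mulDr x y z : pqs_mul x (y + z) = pqs_mul x y + pqs_mul x z by exact: linearD.
have antipodeE v : antipode (M K (tensor_word (rev v))) = antipode_rev v.
  by rewrite antipode_tensor_word revK.
have counit_lin : linear (fun x => pqs_counit x *: pqs_one K).
  by move=> a x y; rewrite /pqs_counit mcoeffD mcoeffZ scalerDl scalerA.
have counitE r : pqs_counit (M K (tensor_word (rev r))) *: pqs_one K = delta (pqs_one K) r.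
  rewrite /pqs_counit mcoeffU tensor_word_eq0; case: r => [|a r].
    by rewrite scale1r.
  by rewrite -size_eq0 size_rev scale0r.
move=> x; split; move: x;
  (apply: malg_eq_linear; [exact: convolution_linear|exact: counit_lin|]) => p;
  (* The basis element is written as the word [rev r], the form to which the abstract identities
     apply. *)
  rewrite -/(M K p) -(lettersK p) -(revK (letters p)) counitE convolution_word;
  rewrite splitsum_rev; move: (rev _) => r.
- apply: (etrans _ (antipode_left (c := tensor_letter) letter_bulletA
    pqs_mul1l pqs_mul1r pqs_mulDl pqs_mul_letter r)).
  by apply: eq_splitsum => u v; congr pqs_mul;
    [exact: antipodeE | exact/esym/word_tensor_word].
- apply: (etrans _ (antipode_right (c := tensor_letter)
    pqs_mul1l pqs_mul1r mulDr pqs_mul_letter r)).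
  by apply: eq_splitsum => u v; congr pqs_mul;
    [exact/esym/word_tensor_word | exact: antipodeE].
Qed.
End ParQSym.

(** * Diagrams with isolated upper nodes *)

Section Subspace.
Variables (K : fieldType) (V : lmodType K).

Lemma subspace_sum (W : set V) (I : Type) (r : seq I) (P : pred I) (F : I -> V) :
  subspace W -> (forall i, P i -> W (F i)) -> W (\sum_(i <- r | P i) F i).
Proof. by case=> W0 WD _ WF; elim/big_ind: _. Qed.

Lemma lin_span_subspace (G : set V) : subspace (lin_span G).
Proof.
split=> [|x y [n [a [g [gG ->]]]] [m [b [h [hG ->]]]]|c x [n [a [g [gG ->]]]]].
- exists 0%N, (fun _ => 0), (fun _ => 0); split; first by case.
  by rewrite big_ord0.
- exists (n + m)%N, (fun i => match split i with inl j => a j | inr j => b j end),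
    (fun i => match split i with inl j => g j | inr j => h j end); split.
    by move=> i; case: (split i).
  rewrite big_split_ord /=; congr (_ + _); apply: eq_bigr => i _.
    by rewrite (unsplitK (inl i)).
  by rewrite (unsplitK (inr i)).
- exists n, (fun i => c * a i), g; split=> //.
  by rewrite scaler_sumr; apply: eq_bigr => i _; rewrite scalerA.
Qed.

Lemma mem_lin_span (G : set V) v : G v -> lin_span G v.
Proof.
by move=> Gv; exists 1%N, (fun _ => 1), (fun _ => v); rewrite big_ord1 scale1r.
Qed.

End Subspace.

(** * Stability of the span under the Hopf operations *)

Section UpperIsolated.
Variable K : fieldType.
Notation W := (upper_isolated_span K).

Lemma upper_isolated_spanP x :
  W x <-> forall p, p \in msupp x -> upper_isolated p.
Proof.
split=> [[n [a [g [gW ->]]]] p|xW].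
  rewrite -mcoeff_neq0 raddf_sum /=; apply: contra_neqP => np.
  apply: big1 => i _; have [q uq ->] := gW i.
  rewrite mcoeffZ mcoeffU; case: eqP => [eqp|_]; last by rewrite mulr0.
  by rewrite -eqp in np.
rewrite [x]monalgE big_seq; apply: subspace_sum => [|p px].
  exact: lin_span_subspace.
have -> : << x@_p *g p >> = x@_p *: M K p.
  by apply/malgP => k; rewrite mcoeffZ !mcoeffU mulrnAr mulr1.
have [_ _ WZ] := lin_span_subspace [set x | exists2 p, upper_isolated p & x = M K p].
by apply/WZ/mem_lin_span; exists p => //; apply: xW.
Qed.

Lemma upper_isolated_span_subspace : subspace W.
Proof. exact: lin_span_subspace. Qed.

Lemma upper_isolated_spanM p : upper_isolated p -> W (M K p).
Proof. by move=> up; apply: mem_lin_span; exists p. Qed.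

(** Reduces each stability claim below to basis elements. *)
Lemma subspace_lin_ext (V : lmodType K) (U : set V) f x :
  subspace U -> (forall p, upper_isolated p -> U (f p)) -> W x -> U (lin_ext f x).
Proof.
move=> sU fU /upper_isolated_spanP xW; rewrite /lin_ext big_seq.
apply: subspace_sum => // p px; case: sU => _ _ UZ.
exact/UZ/fU/xW.
Qed.

Lemma upper_isolated_graded : graded_subspace W.
Proof.
split=> [|n x /upper_isolated_spanP xW]; first exact: lin_span_subspace.
rewrite /homogeneous_component big_seq_cond; apply: subspace_sum => [|p /andP[px _]].
  exact: lin_span_subspace.
have [_ _ WZ] := upper_isolated_span_subspace.
by apply/WZ/upper_isolated_spanM/xW.
Qed.

Lemma upper_isolated_mulM p q :
  upper_isolated p -> upper_isolated q -> W (pqs_mulM K p q).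
Proof.
move=> up uq; rewrite /pqs_mulM fsbig_finite; last exact: finite_paddings.
rewrite big_seq; apply: subspace_sum => [|s]; first exact: lin_span_subspace.
rewrite in_fset_set; last exact: finite_paddings.
rewrite inE => -[[_ ep] [_ eq] _]; apply: upper_isolated_spanM.
(* A non-empty entry of a padding is a tensor factor of [p] or [q], and an empty one has no upper
   node. *)
have aux l : upper_isolated (foldr tensor pd_empty (nonempty_entries l)) ->
    forall r, r \in l -> upper_isolated r.
  elim: l => // r l IH; rewrite nonempty_entries_cons; case: eqP => [->|_] /=.
    by move/IH => ul t; rewrite inE => /predU1P[->|/ul //]; apply: upper_isolated_empty.
  by move/upper_isolated_tensor=> [ur /IH ul] t; rewrite inE => /predU1P[->|/ul].
have {aux} [us1 us2] : (forall r, r \in unzip1 s -> upper_isolated r) /\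
                 (forall r, r \in unzip2 s -> upper_isolated r).
  by split; apply: aux; rewrite -?ep -?eq.
elim: s us1 us2 {ep eq} => [|t s IH] us1 us2 /=; first exact: upper_isolated_empty.
apply/upper_isolated_tensor; split.
  by apply: upper_isolated_bullet; [apply: us1|apply: us2]; rewrite inE eqxx.
by apply: IH => r rs; [apply: us1|apply: us2]; rewrite inE rs orbT.
Qed.

Lemma upper_isolated_subalgebra : subalgebra W.
Proof.
split=> [|x y Wx Wy]; first exact/upper_isolated_spanM/upper_isolated_empty.
apply: subspace_lin_ext => // [|p up]; first exact: lin_span_subspace.
apply: subspace_lin_ext => // [|q uq]; first exact: lin_span_subspace.
exact: upper_isolated_mulM.
Qed.

Lemma upper_isolated_subcoalgebra : subcoalgebra W.
Proof.
move=> x Wx; apply: subspace_lin_ext => // [|p up]; first exact: lin_span_subspace.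
rewrite /pqs_comulM fsbig_finite; last exact: finite_deconcatenations.
rewrite big_seq; apply: subspace_sum => [|t]; first exact: lin_span_subspace.
rewrite in_fset_set; last exact: finite_deconcatenations.
rewrite inE /deconcatenations /= => e.
move: up; rewrite -e => /upper_isolated_tensor[u1 u2].
apply: mem_lin_span; exists (M K t.1), (M K t.2).
by split=> //; apply: upper_isolated_spanM.
Qed.

Lemma upper_isolated_tensor_letter (a : letter) x :
  upper_isolated (val a) -> W x -> W (tensor_letter a x).
Proof.
move=> ua; apply: subspace_lin_ext => [|p up]; first exact: lin_span_subspace.
by apply/upper_isolated_spanM/upper_isolated_tensor.
Qed.

Lemma upper_isolated_antipode_rev r :
  (forall a : letter, a \in r -> upper_isolated (val a)) -> W (antipode_rev K r).
Proof.
have [W0 WD WZ] := upper_isolated_span_subspace.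
have WN x : W x -> W (- x) by rewrite -scaleN1r; apply: WZ.
have W1 : W (pqs_one K) by apply/upper_isolated_spanM/upper_isolated_empty.
case: r => // b r ur; apply: (WN).
have /ur ub := mem_head b r.
have {}ur (a : letter) : a \in r -> upper_isolated (val a).
  by move=> ar; apply: ur; rewrite inE ar orbT.
elim: r b ub ur => [|a r IH] b ub ur /=; first exact: upper_isolated_tensor_letter.
have ua : upper_isolated (val a) by apply: ur; apply: mem_head.
have {}ur (c : letter) : c \in r -> upper_isolated (val c).
  by move=> cr; apply: ur; rewrite inE cr orbT.
(* The fused block [bullet a b] again has isolated upper nodes, so the induction hypothesis, stated
   for every block, applies to it. *)
apply: WD; last by apply: (WN); apply: IH => //; apply: upper_isolated_bullet.
by apply: upper_isolated_tensor_letter => //; apply/WN/IH.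
Qed.

(** The letters of a diagram are its tensor factors, so they inherit isolation. *)
Lemma upper_isolated_antipode x : W x -> W (antipode x).
Proof.
apply: subspace_lin_ext => [|p up]; first exact: lin_span_subspace.
apply: upper_isolated_antipode_rev => a; rewrite mem_rev.
rewrite -(lettersK p) in up; elim: (letters p) up => // b w IH.
move/upper_isolated_tensor => [ub uw]; rewrite inE => /predU1P[->//|].
exact: IH.
Qed.

End UpperIsolated.

Theorem theorem3p3 (K : fieldType) :
  graded_subspace (upper_isolated_span K) /\
  hopf_subalgebra (upper_isolated_span K).
Proof.
split; first exact: upper_isolated_graded.
split; [exact: upper_isolated_span_subspace | exact: upper_isolated_subalgebra
  | exact: upper_isolated_subcoalgebra |].
exists (@antipode K : {linear ParQSym K -> ParQSym K}).
  exact: antipodeP.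
exact: upper_isolated_antipode.
Qed.
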